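(* For every $t\in[1,2]$ and every $\eta\in(0,1)$, provided the constant $c_I$ in the definition of $I$ is chosen sufficiently small depending only on $\eta$, the $\eta$-minimax separation radius satisfies $$\rho^*_{p,t,n}(\eta)\asymp_{\eta,t}\sqrt{\frac{\|p_{\le I}\|_r}{n}}+\frac{\|p_{>I}\|_1^{\frac{2-t}{t}}}{n^{\frac{2t-2}{t}}}+\frac1n,$$ i.e. there are constants $0<c\le C$ depending only on $\eta$ and $t$ such that $\rho^*$ lies between $c$ and $C$ times the right-hand side, for all $N\ge2$, all even $n\ge2$ and all $p$ satisfying the standing assumptions.
   Context: Binomial model: let $N\ge 2$ and $n\ge 2$ be even, $k=n/2$. For $q=(q_1,\dots,q_N)\in[0,1]^N$ one observes $X_1,\dots,X_n$ i.i.d., each $X_l=(X_l(1),\dots,X_l(N))\in\{0,1\}^N$ having mutually independent coordinates $X_l(j)\sim\mathrm{Ber}(q_j)$; $\mathbb P_q$ denotes the joint law of $(X_1,\dots,X_n)$. For $x\in\mathbb R^N$ and $s>0$, $\|x\|_s=(\sum_j|x_j|^s)^{1/s}$. Fix a known $p\in[0,1]^N$, $t\in[1,2]$, $\eta\in(0,1)$. A test is a measurable $\psi:(\{0,1\}^N)^n\to\{0,1\}$; its risk at radius $\rho>0$ is $R_\rho(\psi)=\mathbb P_p(\psi=1)+\sup_{q\in[0,1]^N:\|p-q\|_t\ge\rho}\mathbb P_q(\psi=0)$; the minimax risk is $R^*_\rho=\inf_\psi R_\rho(\psi)$; the $\eta$-minimax separation radius is $\rho^*=\rho^*_{p,t,n}(\eta)=\inf\{\rho>0:R^*_\rho\le\eta\}$.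 Standing assumptions: $p_1\ge p_2\ge\dots\ge p_N$ and $\max_jp_j\le1/2$. Notation: $r=\frac{2t}{4-t}$, $b=\frac{4-2t}{4-t}$; for an index $u$ and a vector $x$, $x_{\le u}=(x_1,\dots,x_u,0,\dots,0)$, $x_{>u}=(0,\dots,0,x_{u+1},\dots,x_N)$, and $x_{\ge u}=x_{>u-1}$. $I=\min\{J\in\{0,\dots,N\}:\sum_{i>J}p_i^2\le c_I/n^2\}$ where $c_I>0$ is a sufficiently small constant depending only on $\eta$. $f\lesssim g$ means $f\le Cg$ for a constant $C$ depending only on the indicated parameters; $f\asymp g$ means $f\lesssim g$ and $g\lesssim f$. *)

(* Defs.v *)
From HB Require Import structures.
From mathcomp Require Import all_boot all_order all_algebra.
From mathcomp Require Import all_classical all_reals all_analysis.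
Set Implicit Arguments. Unset Strict Implicit. Unset Printing Implicit Defensive.
Import Order.TTheory GRing.Theory Num.Theory.
Local Open Scope classical_set_scope.
Local Open Scope ring_scope.

Section Binomial.
Variable R : realType.

(* a vector of R^N, coordinates indexed 0..N-1 (paper's index j is our j-1) *)
Definition vec (N : nat) := 'I_N -> R.

Definition lpnorm (N : nat) (s : R) (x : vec N) : R :=
  (\sum_(j < N) `|x j| `^ s) `^ s^-1.

Definition trunc_le (N u : nat) (x : vec N) : vec N :=
  fun j => if (j < u)%N then x j else 0.
Definition trunc_gt (N u : nat) (x : vec N) : vec N :=
  fun j => if (u <= j)%N then x j else 0.

Definition obs (N : nat) := {ffun 'I_N -> bool}.
Definition sample (N n : nat) := {ffun 'I_n -> obs N}.

(* P_q of a single sample point: independent Bernoulli(q_j) coordinates,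
   i.i.d. observations *)
Definition Pq_pt (N n : nat) (q : vec N) (x : sample N n) : R :=
  \prod_(l < n) \prod_(j < N) (if x l j then q j else 1 - q j).

Definition Pq (N n : nat) (q : vec N) (A : pred (sample N n)) : R :=
  \sum_(x | A x) Pq_pt q x.

Definition test (N n : nat) := sample N n -> bool.

Definition in_cube (N : nat) (q : vec N) : Prop := forall j, 0 <= q j <= 1.

(* R_rho(psi) = P_p(psi=1) + sup_{q in [0,1]^N, ||p-q||_t >= rho} P_q(psi=0)
   (sup of the empty set is 0) *)
Definition risk (N n : nat) (p : vec N) (t rho : R) (psi : test N n) : R :=
  Pq p (fun x => psi x) +
  sup [set Pq q (fun x => ~~ psi x) | q in
        [set q : vec N | in_cube q /\ rho <= lpnorm t (fun j => p j - q j)]].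

Definition minimax_risk (N n : nat) (p : vec N) (t rho : R) : R :=
  inf [set risk p t rho psi | psi in [set: test N n]].

Definition sep_radius (N n : nat) (p : vec N) (t eta : R) : R :=
  inf [set rho : R | 0 < rho /\ minimax_risk n p t rho <= eta].

(* sum_{i > J} p_i^2 (paper indexing), i.e. 0-based indices i >= J *)
Definition tail_sq (N : nat) (p : vec N) (J : nat) : R :=
  \sum_(i < N | (J <= i)%N) p i ^+ 2.

(* I = min { J in {0,...,N} : sum_{i>J} p_i^2 <= c_I / n^2 }
   (find returns the position of the first J in 0,1,...,N satisfying it) *)
Definition Iidx (N n : nat) (cI : R) (p : vec N) : nat :=
  find (fun J => tail_sq p J <= cI / (n%:R ^+ 2)) (iota 0 N.+1).

Definition r_exp (t : R) : R := 2 * t / (4 - t).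

Definition rate (N n : nat) (cI t : R) (p : vec N) : R :=
  let I := Iidx n cI p in
  Num.sqrt (lpnorm (r_exp t) (trunc_le I p) / n%:R)
  + lpnorm 1 (trunc_gt I p) `^ ((2 - t) / t) / (n%:R `^ ((2 * t - 2) / t))
  + 1 / n%:R.

Definition standing (N : nat) (p : vec N) : Prop :=
  (forall j, 0 <= p j <= 1) /\
  (forall i j : 'I_N, (i <= j)%N -> p j <= p i) /\
  (forall j, p j <= 1 / 2).

End Binomial.

(* Main.v *)
(* Upper bound.  Split the sample into two halves and write [S_j], [S'_j] for
   the centred counts of coordinate [j] in each.  Two statistics of the form
   [sum_j w_j S_j S'_j] and the total count of the tail coordinates suffice.  On
   the bulk [j < I] the weights are [w_j = max(p_j, tau)^(- b)], where the floor
   [tau = 1 / (k sqrt I)], [k = n / 2], keeps every weight below [k] times the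
   null standard deviation; on the tail [w_j = 1].  Chebyshev's inequality
   controls both errors, and interpolation between weighted l2 and a second sum
   turns a large [||p - q||_t] into a large mean of one of the statistics.

   Lower bound.  A single coordinate shifted by [1 / n] gives the term [1 / n].
   For the tail, [q_j] is [h = c / (n^2 ||p_{>I}||_1)] with probability
   [p_j / h] and [0] otherwise.  For the bulk, [q_j = p_j +- g_j] with
   [g_j] proportional to [p_j^(2 / (4 - t))], compared to [p] in chi-square;
   the coordinates where this would force [g_j > p_j] only matter when the
   bulk term of the rate is dominated by the tail term.

   The last point and the cost of the floor [tau] both rest on [mesh_le]: the
   quantity [I^((2 - t) / (2 t)) / n] never exceeds a constant times the rate. *)
Require Import Defs.
From HB Require Import structures.
From mathcomp Require Import all_boot all_order all_algebra.
From mathcomp Require Import all_classical all_reals all_analysis.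
From mathcomp Require Import ring lra.
Import Order.TTheory GRing.Theory Num.Theory.
Local Open Scope ring_scope.

(** * Product Bernoulli laws *)

Section ProductBernoulli.
Context {R : realType} {N n : nat}.
Implicit Types (q : vec R N) (x y : sample N n).

Definition expect q (f : sample N n -> R) : R := \sum_x Pq_pt q x * f x.

(** Distributivity, first over observations and then over coordinates. Total mass, single-entry
    means, prior averages and likelihood-ratio moments all reduce to this factorisation. *)
Lemma sum_sample_prod (g : 'I_n -> 'I_N -> bool -> R) :
  \sum_(x : sample N n) \prod_(l < n) \prod_(j < N) g l j (x l j)
  = \prod_(l < n) \prod_(j < N) (g l j true + g l j false).
Proof.
transitivity (\prod_(l < n) \sum_(a : obs N) \prod_(j < N) g l j (a j)).
  by rewrite bigA_distr_bigA.
apply: eq_bigr => l _; rewrite -bigA_distr_bigA.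
by apply: eq_bigr => j _; rewrite big_bool.
Qed.

Lemma Pq_pt_ge0 q x : in_cube q -> 0 <= Pq_pt q x.
Proof.
move=> hq; apply: prodr_ge0 => l _; apply: prodr_ge0 => j _.
by have /andP[q0 q1] := hq j; case: (x l j); rewrite ?subr_ge0.
Qed.

Lemma expect1 q : expect q (fun=> 1) = 1.
Proof.
rewrite /expect; under eq_bigr do rewrite mulr1.
rewrite /Pq_pt (sum_sample_prod (fun l j b => if b then q j else 1 - q j)).
by rewrite big1 // => l _; rewrite big1 // => j _; rewrite addrC subrK.
Qed.

Lemma eq_expect q f g : f =1 g -> expect q f = expect q g.
Proof. by move=> fg; apply: eq_bigr => x _; rewrite fg. Qed.

Lemma expectZ q a f : expect q (fun x => a * f x) = a * expect q f.
Proof. by rewrite mulr_sumr; apply: eq_bigr => x _; rewrite mulrCA. Qed.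

Lemma expectD q f g : expect q (fun x => f x + g x) = expect q f + expect q g.
Proof. by rewrite -big_split; apply: eq_bigr => x _; rewrite mulrDr. Qed.

Lemma expect_cst q a : expect q (fun=> a) = a.
Proof.
by rewrite -[RHS]mulr1 -(expect1 q) -expectZ; apply: eq_expect => x; rewrite mulr1.
Qed.

Lemma expect_sum q (T : finType) (P : pred T) (f : T -> sample N n -> R) :
  expect q (fun x => \sum_(i | P i) f i x) = \sum_(i | P i) expect q (f i).
Proof.
by rewrite exchange_big; apply: eq_bigr => x _; rewrite mulr_sumr.
Qed.

Lemma expect_le q f g : in_cube q -> (forall x, f x <= g x) ->
  expect q f <= expect q g.
Proof.
by move=> hq fg; apply: ler_sum => x _; rewrite ler_wpM2l // Pq_pt_ge0.
Qed.

Lemma PqE q (A : pred (sample N n)) : Pq q A = expect q (fun x => (A x)%:R).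
Proof.
by rewrite /Pq big_mkcond; apply: eq_bigr => x _; case: (A x); rewrite ?mulr1 ?mulr0.
Qed.

Lemma Pq_ge0 q (A : pred (sample N n)) : in_cube q -> 0 <= Pq q A.
Proof. by move=> hq; apply: sumr_ge0 => x _; apply: Pq_pt_ge0. Qed.

Lemma Pq_le q (A B : pred (sample N n)) : in_cube q -> (forall x, A x -> B x) ->
  Pq q A <= Pq q B.
Proof.
move=> hq AB; rewrite !PqE; apply: expect_le => // x.
by rewrite /=; have := AB x; case: (A x); case: (B x) => // h; have := h isT.
Qed.

Lemma Pq_le1 q (A : pred (sample N n)) : in_cube q -> Pq q A <= 1.
Proof.
by move=> hq; rewrite PqE -[leRHS](expect1 q); apply: expect_le => // x /=; case: (A x).
Qed.

Lemma PqC q (A : pred (sample N n)) : Pq q (fun x => ~~ A x) = 1 - Pq q A.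
Proof.
rewrite !PqE -[X in X - _](expect1 q); apply/eqP; rewrite -subr_eq opprK -expectD; apply/eqP.
by apply: eq_expect => x; case: (A x); rewrite ?addr0 ?add0r.
Qed.

Lemma Pq_or q (A B : pred (sample N n)) : in_cube q ->
  Pq q (fun x => A x || B x) <= Pq q A + Pq q B.
Proof.
move=> hq; rewrite !PqE -expectD; apply: expect_le => // x.
by case: (A x); case: (B x); rewrite /= -?natrD ler_nat.
Qed.

(** * Independence, second moments and Chebyshev's inequality *)

Definition mix (A : 'I_n -> 'I_N -> bool) x y : sample N n :=
  [ffun l => [ffun j => if A l j then x l j else y l j]].

(* Exchanging the coordinates outside [A] between two independent copies of
   the sample preserves their joint law. *)
Lemma expect_indep (A : 'I_n -> 'I_N -> bool) q f g :
  (forall x y, (forall l j, A l j -> x l j = y l j) -> f x = f y) ->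
  (forall x y, (forall l j, ~~ A l j -> x l j = y l j) -> g x = g y) ->
  expect q (fun x => f x * g x) = expect q f * expect q g.
Proof.
move=> hf hg.
pose sw (xy : sample N n * sample N n) := (mix A xy.1 xy.2, mix A xy.2 xy.1).
have swK : involutive sw.
  move=> [x y]; rewrite /sw /=; congr pair;
    by apply/ffunP => l; apply/ffunP => j; rewrite !ffunE; case: (A l j).
transitivity (\sum_(xy : sample N n * sample N n)
   Pq_pt q xy.1 * Pq_pt q xy.2 * (f xy.1 * g xy.1)).
  rewrite -(pair_bigA _ (fun x y => Pq_pt q x * Pq_pt q y * (f x * g x))) /=.
  apply: eq_bigr => x _; rewrite -[LHS]mulr1 -[X in _ * X](expect1 q) /expect mulr_sumr.
  by apply: eq_bigr => y _; ring.
rewrite (reindex_inj (inv_inj swK)) /=.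
rewrite /expect mulr_suml.
under [RHS]eq_bigr do rewrite mulr_sumr.
rewrite pair_bigA /=; apply: eq_bigr => -[x y] _ /=.
rewrite (hf (mix A x y) x); last by move=> l j Alj; rewrite !ffunE Alj.
rewrite (hg (mix A x y) y); last first.
  by move=> l j /negbTE Alj; rewrite !ffunE Alj.
(* Entry by entry the two factors agree up to order. *)
have -> : Pq_pt q (mix A x y) * Pq_pt q (mix A y x) = Pq_pt q x * Pq_pt q y.
  rewrite /Pq_pt -!big_split; apply: eq_bigr => l _ /=.
  rewrite -!big_split; apply: eq_bigr => j _ /=.
  by rewrite !ffunE; case: (A l j); rewrite // mulrC.
by ring.
Qed.

Lemma expect_coord q (l : 'I_n) (j : 'I_N) (phi : bool -> R) :
  expect q (fun x => phi (x l j)) = q j * phi true + (1 - q j) * phi false.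
Proof.
(* [phi] becomes a product over all entries, equal to 1 off [(l, j)], so that every other factor
   sums to 1. *)
pose g (l' : 'I_n) (j' : 'I_N) (b : bool) := (if b then q j' else 1 - q j') *
  (if (l' == l) && (j' == j) then phi b else 1).
transitivity (\sum_(x : sample N n) \prod_(l' < n) \prod_(j' < N) g l' j' (x l' j')).
  apply: eq_bigr => x _; rewrite /Pq_pt.
  have -> : phi (x l j) = \prod_(l' < n) \prod_(j' < N)
     (if (l' == l) && (j' == j) then phi (x l' j') else 1).
    rewrite (bigD1 l) //= (bigD1 j) //= !eqxx /= big1 ?mulr1; last first.
      by move=> j' /negbTE ->.
    rewrite big1 ?mulr1 // => l' /negbTE ->; by rewrite big1.
  by rewrite -big_split; apply: eq_bigr => l' _; rewrite -big_split.
rewrite sum_sample_prod (bigD1 l) //= (bigD1 j) //= /g !eqxx /=.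
rewrite big1 ?mulr1; last by move=> j' /negbTE -> /=; ring.
rewrite big1 ?mulr1 // => l' /negbTE -> /=.
by rewrite big1 // => j' _; ring.
Qed.

(** For pairwise uncorrelated terms the cross products recombine into the squared mean; the last sum
    is the variance of the total. *)
Lemma expect_sum_sqr q (T : finType) (P : pred T) (Y : T -> sample N n -> R)
    (m : T -> R) :
  (forall i, P i -> expect q (Y i) = m i) ->
  (forall i j, P i -> P j -> i != j ->
     expect q (fun x => Y i x * Y j x) = m i * m j) ->
  expect q (fun x => (\sum_(i | P i) Y i x) ^+ 2) = (\sum_(i | P i) m i) ^+ 2
    + \sum_(i | P i) (expect q (fun x => Y i x ^+ 2) - m i ^+ 2).
Proof.
move=> hm hc.
have -> : expect q (fun x => (\sum_(i | P i) Y i x) ^+ 2)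
  = \sum_(i | P i) \sum_(j | P j) expect q (fun x => Y i x * Y j x).
  under eq_bigr do rewrite -expect_sum.
  rewrite -expect_sum; apply: eq_expect => x; rewrite expr2 mulr_suml.
  by apply: eq_bigr => i _; rewrite mulr_sumr.
rewrite expr2 mulr_suml -big_split; apply: eq_bigr => i Pi /=.
rewrite mulr_sumr (bigD1 i) //= [in RHS](bigD1 i) //=.
rewrite (eq_bigr (fun j => m i * m j)); last first.
  by move=> j /andP[Pj ji]; apply: hc; rewrite // eq_sym.
by rewrite !expr2; ring.
Qed.

Lemma chebyshev_Pq q (f : sample N n -> R) (A : pred (sample N n)) (a s : R) :
  in_cube q -> 0 < s -> (forall x, A x -> s <= `|f x - a|) ->
  Pq q A <= expect q (fun x => (f x - a) ^+ 2) / s ^+ 2.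
Proof.
move=> hq s0 hA; rewrite PqE mulrC -expectZ; apply: expect_le => // x.
have s20 : 0 < s ^+ 2 by rewrite exprn_gt0.
case Ax: (A x) => /=; last by rewrite mulr_ge0 ?invr_ge0 ?sqr_ge0 // ltW.
rewrite mulrC ler_pdivlMr // mul1r -[leRHS]real_normK ?num_real //.
by rewrite lerXn2r ?nnegrE ?(ltW s0) // hA.
Qed.

Lemma expect_sqr_centered q (f : sample N n -> R) a : expect q f = a ->
  expect q (fun x => (f x - a) ^+ 2) = expect q (fun x => f x ^+ 2) - a ^+ 2.
Proof.
move=> fa.
have -> : expect q (fun x => (f x - a) ^+ 2) =
  expect q (fun x => f x ^+ 2 + ((- (2 * a)) * f x + a ^+ 2)).
  by apply: eq_expect => x; ring.
by rewrite !expectD expectZ expect_cst fa; ring.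
Qed.

End ProductBernoulli.

(** * Test statistics *)

Section Statistics.
Context {R : realType} {N n : nat}.
Implicit Types (p q w : vec R N) (x y : sample N n) (H : pred 'I_n).

Definition half_sum H p x (j : 'I_N) : R := \sum_(l < n | H l) ((x l j)%:R - p j).

Lemma expect_half_sum H p q j :
  expect q (fun x => half_sum H p x j) = #|H|%:R * (q j - p j).
Proof.
rewrite expect_sum (eq_bigr (fun=> q j - p j)) => [|l _].
  by rewrite sumr_const mulr_natl.
rewrite (expect_coord q l j (fun b => b%:R - p j)) /=; ring.
Qed.

Lemma expect_half_sum_sqr H p q j :
  expect q (fun x => half_sum H p x j ^+ 2)
  = #|H|%:R * (q j * (1 - q j)) + (#|H|%:R * (q j - p j)) ^+ 2.
Proof.
rewrite (expect_sum_sqr q _ H (fun l x => (x l j)%:R - p j) (fun=> q j - p j)).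
- have hc (c : R) : \sum_(l < n | H l) c = #|H|%:R * c.
    by rewrite sumr_const mulr_natl.
  rewrite addrC hc; congr (_ + _); rewrite -hc; apply: eq_bigr => l _.
  rewrite (expect_coord q l j (fun b => (b%:R - p j) ^+ 2)) /=; ring.
- by move=> l _; rewrite (expect_coord q l j (fun b => b%:R - p j)) /=; ring.
- move=> l l' _ _ ll'.
  rewrite (expect_indep (fun i _ => i == l) q (fun x => (x l j)%:R - p j)
    (fun x => (x l' j)%:R - p j)).
  + rewrite (expect_coord q l j (fun b => b%:R - p j)).
    by rewrite (expect_coord q l' j (fun b => b%:R - p j)) /=; ring.
  + by move=> x y xy; rewrite xy.
  + by move=> x y xy; rewrite xy // eq_sym.
Qed.

Lemma eq_half_sum H p x y j : (forall l, H l -> x l j = y l j) ->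
  half_sum H p x j = half_sum H p y j.
Proof. by move=> xy; apply: eq_bigr => l Hl; rewrite xy. Qed.

Definition first_half : pred 'I_n := fun l => (l < n./2)%N.

(** Multiplying counts from two independent halves estimates [(q j - p j)^2] up to the factor [k^2]
    without the diagonal bias of a squared count. *)
Definition quad_stat w p x : R :=
  \sum_j w j * (half_sum first_half p x j * half_sum (predC first_half) p x j).

(** One sum over pairs, so that [expect_sum_sqr] applies directly. With [n = 1] it also counts the
    active coordinates of the sparse prior. *)
Definition count_stat (J : pred 'I_N) x : R :=
  \sum_(lj : 'I_n * 'I_N | J lj.2) (x lj.1 lj.2)%:R.

Lemma expect_count_stat J q :
  expect q (count_stat J) = n%:R * \sum_(j | J j) q j.
Proof.
rewrite expect_sum (eq_bigr (fun lj => q lj.2)); last first.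
  by move=> [l j] _; rewrite (expect_coord q l j (fun b => b%:R)) /=; ring.
rewrite -(pair_big xpredT J (fun (l : 'I_n) j => q j)) /=.
by rewrite sumr_const card_ord mulr_natl.
Qed.

(** Markov's inequality. *)
Lemma Pq_count_stat_ge J p (s : R) : in_cube p -> 0 < s ->
  Pq p (fun x => s <= count_stat J x) <= n%:R * (\sum_(j | J j) p j) / s.
Proof.
move=> hp s0; rewrite PqE -expect_count_stat mulrC -expectZ.
apply: expect_le => // x /=.
have c0 : 0 <= count_stat J x by apply: sumr_ge0.
case: (boolP (s <= count_stat J x)) => [h|_] /=; last by rewrite mulr_ge0 // invr_ge0 ltW.
by rewrite mulrC ler_pdivlMr // mul1r.
Qed.

(** Chebyshev's inequality: the variance of a sum of independent Bernoulli variables is at most its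
    mean [m], and [m / (m / 2)^2 = 4 / m]. *)
Lemma Pq_count_stat_lt J q (m : R) : in_cube q ->
  m = n%:R * (\sum_(j | J j) q j) -> 0 < m ->
  Pq q (fun x => count_stat J x < m / 2) <= 4 / m.
Proof.
move=> hq mE m0.
have m20 : 0 < m / 2 by lra.
apply: le_trans (chebyshev_Pq q (count_stat J) _ m (m / 2) hq m20 _) _.
  move=> x; set c := count_stat J x => cm; rewrite distrC ger0_norm; lra.
rewrite expect_sqr_centered; last by rewrite expect_count_stat mE.
have -> : expect q (fun x => count_stat J x ^+ 2) = m ^+ 2
    + \sum_(lj : 'I_n * 'I_N | J lj.2) (q lj.2 - q lj.2 ^+ 2).
  rewrite (expect_sum_sqr q _ (fun lj : 'I_n * 'I_N => J lj.2)
    (fun lj x => (x lj.1 lj.2)%:R) (fun lj => q lj.2)).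
  - congr (_ ^+ 2 + _).
      rewrite -(pair_big xpredT J (fun (l : 'I_n) j => q j)) /=.
      by rewrite mE sumr_const card_ord mulr_natl.
    apply: eq_bigr => -[l j] _; rewrite (expect_coord q l j (fun b => b%:R ^+ 2)) /=.
    by ring.
  - by move=> [l j] _; rewrite (expect_coord q l j (fun b => b%:R)) /=; ring.
  - move=> [l j] [l' j'] /= _ _ lj.
    rewrite (expect_indep (fun l0 j0 => (l0, j0) == (l, j)) q
      (fun x => (x l j)%:R) (fun x => (x l' j')%:R)).
    + rewrite (expect_coord q l j (fun b => b%:R)).
      by rewrite (expect_coord q l' j' (fun b => b%:R)) /=; ring.
    + by move=> x y -> //=.
    + by move=> x y -> //; rewrite eq_sym.
have hs : \sum_(lj : 'I_n * 'I_N | J lj.2) (q lj.2 - q lj.2 ^+ 2) <= m.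
  rewrite mE mulr_natl -[X in _ *+ X]card_ord -sumr_const.
  rewrite (pair_big xpredT J (fun (l : 'I_n) j => q j)) /=.
  by apply: ler_sum => -[l j] _ /=; rewrite gerBl sqr_ge0.
rewrite ler_pdivrMr ?exprn_gt0 // addrAC subrr add0r.
have -> : 4 / m * (m / 2) ^+ 2 = m by field; rewrite gt_eqF.
by [].
Qed.

(** * The quadratic statistic under the null and under an alternative *)

Hypothesis n_even : ~~ odd n.
Let k : R := n./2%:R.

Lemma card_first_half : #|first_half|%:R = k /\ #|predC first_half|%:R = k :> R.
Proof.
have nE : n = (n./2 + n./2)%N by rewrite addnn even_halfK.
have c1 : #|first_half| = n./2.
  rewrite -sum1_card.
  have le : (n./2 <= n)%N by rewrite {2}nE leq_addr.
  transitivity (\sum_(i < n | (i < n./2)%N) 1)%N; first exact: eq_bigl.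
  by rewrite (big_ord_narrow le) sum1_card card_ord.
have c2 : #|predC first_half| = n./2.
  apply: (@addnI n./2); rewrite -{1}c1 -nE -[RHS]card_ord.
  exact: (cardC first_half).
by rewrite c1 c2.
Qed.

(** With [d = q j - p j] and [v = q j (1 - q j)], independence of the halves gives coordinate [j]
    the second moment [w^2 (k v + (k d)^2)^2]. Subtracting the squared mean cancels [d^4], and
    [v <= q j] bounds the rest. *)
Lemma quad_stat_moments w p q : in_cube q ->
  let A := \sum_j w j * (q j - p j) ^+ 2 in
  expect q (quad_stat w p) = k ^+ 2 * A /\
  expect q (fun x => (quad_stat w p x - k ^+ 2 * A) ^+ 2) <=
    k ^+ 2 * \sum_j w j ^+ 2 * (q j ^+ 2 + 2 * k * (q j * (q j - p j) ^+ 2)).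
Proof.
move=> hq A.
have [c1 c2] := card_first_half.
pose Y (j : 'I_N) x :=
  w j * (half_sum first_half p x j * half_sum (predC first_half) p x j).
have EY j : expect q (Y j) = k ^+ 2 * (w j * (q j - p j) ^+ 2).
  rewrite /Y expectZ (expect_indep (fun l _ => first_half l)).
  - by rewrite !expect_half_sum c1 c2; ring.
  - by move=> x y xy; apply: eq_half_sum => l; apply: xy.
  - by move=> x y xy; apply: eq_half_sum => l; apply: xy.
have ET : expect q (quad_stat w p) = k ^+ 2 * A.
  by rewrite expect_sum mulr_sumr; apply: eq_bigr => j _; apply: EY.
split=> //; rewrite expect_sqr_centered //.
have -> : expect q (fun x => quad_stat w p x ^+ 2) = (k ^+ 2 * A) ^+ 2 +
    \sum_j (expect q (fun x => Y j x ^+ 2) - (k ^+ 2 * (w j * (q j - p j) ^+ 2)) ^+ 2).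
  rewrite mulr_sumr; apply: (expect_sum_sqr q _ xpredT Y) => [j _|i j _ _ ij]; first exact: EY.
  rewrite (expect_indep (fun _ j' => j' == i)).
  - by rewrite !EY.
  - move=> x y xy; rewrite /Y; congr (_ * (_ * _)); apply: eq_half_sum => l _;
    by rewrite xy.
  - move=> x y xy; rewrite /Y; congr (_ * (_ * _)); apply: eq_half_sum => l _;
    by rewrite xy // eq_sym.
rewrite addrC addrA addNr add0r mulr_sumr; apply: ler_sum => j _.
have -> : expect q (fun x => Y j x ^+ 2) =
    w j ^+ 2 * (k * (q j * (1 - q j)) + (k * (q j - p j)) ^+ 2) ^+ 2.
  rewrite -[X in _ * X ^+ 2]mulr1 (eq_expect _ _ (fun x => w j ^+ 2 *
    (half_sum first_half p x j ^+ 2 * half_sum (predC first_half) p x j ^+ 2))).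
    rewrite expectZ (expect_indep (fun l _ => first_half l)).
    - by rewrite !expect_half_sum_sqr c1 c2; ring.
    - by move=> x y xy; congr (_ ^+ 2); apply: eq_half_sum => l; apply: xy.
    - by move=> x y xy; congr (_ ^+ 2); apply: eq_half_sum => l; apply: xy.
  by move=> x; rewrite /Y; ring.
have /andP[q0 q1] := hq j.
set d := q j - p j; set v := q j * (1 - q j).
have -> : w j ^+ 2 * (k * v + (k * d) ^+ 2) ^+ 2 - (k ^+ 2 * (w j * d ^+ 2)) ^+ 2
  = k ^+ 2 * (w j ^+ 2 * (v ^+ 2 + 2 * k * (v * d ^+ 2))) by ring.
have k0 : 0 <= k by [].
have v0 : 0 <= v by rewrite mulr_ge0 // subr_ge0.
have vq : v <= q j by rewrite ler_piMr // gerBl.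
rewrite ler_wpM2l ?sqr_ge0 // ler_wpM2l ?sqr_ge0 // lerD //.
  by rewrite lerXn2r ?nnegrE.
by rewrite ler_wpM2l ?mulr_ge0 // ler_wpM2r ?sqr_ge0.
Qed.

Hypothesis n_gt1 : (1 < n)%N.

Lemma natr_half_gt0 : 0 < k.
Proof. by rewrite ltr0n half_gt0. Qed.

(** Under [p] the mean vanishes and the standard deviation is at most [k D], so the threshold sits
    [K] such deviations away. *)
Lemma quad_stat_null w p (D K : R) : in_cube p -> 0 < D -> 0 < K ->
  \sum_j w j ^+ 2 * p j ^+ 2 <= D ^+ 2 ->
  Pq p (fun x => K * k * D < quad_stat w p x) <= (K ^+ 2)^-1.
Proof.
move=> hp D0 K0 hD; have k0 := natr_half_gt0.
have s0 : 0 < K * k * D by rewrite !mulr_gt0.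
have [_ /=] := quad_stat_moments w p p hp.
rewrite [\sum_j w j * (p j - p j) ^+ 2]big1 => [|j _]; last by ring.
rewrite mulr0 => hv.
apply: le_trans (chebyshev_Pq p (quad_stat w p) _ 0 (K * k * D) hp s0 _) _.
  by move=> x /ltW h; rewrite subr0; apply: le_trans h (ler_norm _).
rewrite ler_pdivrMr ?exprn_gt0 //; apply: le_trans hv _.
have -> : (K ^+ 2)^-1 * (K * k * D) ^+ 2 = k ^+ 2 * D ^+ 2.
  by field; rewrite gt_eqF.
rewrite ler_wpM2l ?sqr_ge0 //; apply: le_trans hD; rewrite le_eqVlt; apply/orP; left.
by apply/eqP; apply: eq_bigr => j _; ring.
Qed.

(** The mean is [k a] with [a >= C^2 D], and [2 K <= C^2] puts the threshold below half of it.
    Together with the null variance, the cap [w j <= k D] bounds the variance by [8 k^2 a^2 / C],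
    whence [32 / C] by Chebyshev's inequality. *)
Lemma quad_stat_alt w p q (D K C : R) : in_cube p -> in_cube q -> 0 < D -> 1 <= C ->
  2 * K <= C ^+ 2 -> (forall j, 0 <= w j <= k * D) ->
  \sum_j w j ^+ 2 * p j ^+ 2 <= D ^+ 2 ->
  C ^+ 2 * D <= k * \sum_j w j * (q j - p j) ^+ 2 ->
  Pq q (fun x => ~~ (K * k * D < quad_stat w p x)) <= 32 / C.
Proof.
move=> hp hq D0 C1 KC hw hD.
have [_ /=] := quad_stat_moments w p q hq.
set A := \sum_j w j * (q j - p j) ^+ 2 => hv hA; have k0 := natr_half_gt0.
set a := k * A in hA.
have C0 : 0 < C by lra.
have C20 : 0 < C ^+ 2 by rewrite exprn_gt0.
have a0 : 0 < a by apply: lt_le_trans hA; rewrite mulr_gt0.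
have A0 : 0 < A by move: a0; rewrite pmulr_rgt0.
have Da : D <= a / C ^+ 2 by rewrite ler_pdivlMr // mulrC.
have DaC : D <= a / C.
  apply: le_trans Da _; rewrite ler_pM2l // lef_pV2 ?posrE //.
  by rewrite expr2 ler_peMl // ltW.
have aC : a / C <= a by rewrite ler_pdivrMr // ler_peMr // ltW.
have aC0 : 0 < a / C by rewrite divr_gt0.
have wp j : w j * p j <= D.
  have /andP[w0 _] := hw j; have /andP[p0 _] := hp j.
  rewrite -(@ler_pXn2r _ 2) ?nnegrE ?mulr_ge0 ?(ltW D0) //.
  apply: le_trans hD; rewrite exprMn (bigD1 j) //= lerDl.
  by apply: sumr_ge0 => i _; rewrite mulr_ge0 ?sqr_ge0.
(* Squared, this reads [w^2 d^2 <= k D (w d^2) <= k D A = D a <= (a / C)^2]. *)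
have wd j : w j * `|q j - p j| <= a / C.
  have /andP[w0 wk] := hw j.
  rewrite -(@ler_pXn2r _ 2) ?nnegrE ?(ltW aC0) ?mulr_ge0 //.
  rewrite exprMn real_normK ?num_real // expr2 -mulrA.
  have wA : w j * (q j - p j) ^+ 2 <= A.
    rewrite /A (bigD1 j) //= lerDl; apply: sumr_ge0 => i _.
    by have /andP[wi _] := hw i; rewrite mulr_ge0 ?sqr_ge0.
  apply: (@le_trans _ _ (k * D * A)).
    by apply: ler_pM => //; rewrite mulr_ge0 ?sqr_ge0.
  have -> : k * D * A = D * a by rewrite /a; ring.
  have -> : (a / C) ^+ 2 = a / C ^+ 2 * a by field; rewrite gt_eqF.
  by rewrite ler_wpM2r // ltW.
(* From [q^2 <= 2 p^2 + 2 d^2] come the first two terms; the last two come from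
   [w q <= D + a / C]. *)
have var : \sum_j w j ^+ 2 * (q j ^+ 2 + 2 * k * (q j * (q j - p j) ^+ 2))
    <= 2 * D ^+ 2 + 2 * k * D * A + 2 * k * D * A + 2 * k * (a / C) * A.
  apply: (@le_trans _ _ (\sum_j (2 * (w j ^+ 2 * p j ^+ 2) +
    (2 * k * D + 2 * k * D + 2 * k * (a / C)) * (w j * (q j - p j) ^+ 2)))).
    apply: ler_sum => j _.
    have /andP[w0 wk] := hw j; have /andP[p0 _] := hp j.
    have := wp j; have := wd j; set d := q j - p j => wd' wp'.
    have qE : q j = p j + d by rewrite /d; ring.
    have wd2 : 0 <= w j * d ^+ 2 by rewrite mulr_ge0 ?sqr_ge0.
    have h1 : q j ^+ 2 <= 2 * p j ^+ 2 + 2 * d ^+ 2.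
      rewrite qE; have := sqr_ge0 (p j - d); nra.
    have h2 : w j * q j <= D + a / C.
      rewrite qE mulrDr lerD //; apply: le_trans wd'.
      by rewrite ler_wpM2l // ler_norm.
    have h3 : w j ^+ 2 * d ^+ 2 <= k * D * (w j * d ^+ 2).
      by rewrite expr2 -mulrA ler_wpM2r.
    have h4 : w j ^+ 2 * (q j * d ^+ 2) <= (D + a / C) * (w j * d ^+ 2).
      have -> : w j ^+ 2 * (q j * d ^+ 2) = w j * q j * (w j * d ^+ 2) by ring.
      by rewrite ler_wpM2r.
    have h5 := ler_wpM2l (sqr_ge0 (w j)) h1.
    have h6 : 2 * k * (w j ^+ 2 * (q j * d ^+ 2)) <=
      2 * k * ((D + a / C) * (w j * d ^+ 2)).
      by rewrite ler_wpM2l // mulr_ge0 // ltW.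
    set e := a / C in h2 h4 h6 *.
    have -> : w j ^+ 2 * (q j ^+ 2 + 2 * k * (q j * d ^+ 2)) =
      w j ^+ 2 * q j ^+ 2 + 2 * k * (w j ^+ 2 * (q j * d ^+ 2)) by ring.
    apply: le_trans (lerD h5 h6) _.
    have -> : w j ^+ 2 * (2 * p j ^+ 2 + 2 * d ^+ 2) =
      2 * (w j ^+ 2 * p j ^+ 2) + 2 * (w j ^+ 2 * d ^+ 2) by ring.
    have -> : 2 * k * ((D + e) * (w j * d ^+ 2)) =
      (2 * k * D + 2 * k * e) * (w j * d ^+ 2) by ring.
    rewrite -subr_ge0 in h3.
    rewrite -subr_ge0; set X := k * D * _ - _ in h3.
    apply: le_trans (mulr_ge0 (ler0n R 2) h3) _; rewrite /X le_eqVlt; apply/orP; left.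
    by apply/eqP; ring.
  rewrite big_split /= -!mulr_sumr -/A.
  have -> : (2 * k * D + 2 * k * D + 2 * k * (a / C)) * A =
    2 * k * D * A + 2 * k * D * A + 2 * k * (a / C) * A by ring.
  by rewrite !addrA !lerD2r ler_wpM2l.
have varC : 2 * D ^+ 2 + 2 * k * D * A + 2 * k * D * A + 2 * k * (a / C) * A
    <= 8 * (a / C) * a.
  have -> : 2 * k * D * A = 2 * D * a by rewrite /a; ring.
  have -> : 2 * k * (a / C) * A = 2 * (a / C) * a by rewrite /a; ring.
  have h1 : D * a <= a / C * a by rewrite ler_wpM2r // ltW.
  have h2 : D ^+ 2 <= a / C * a.
    by rewrite expr2; apply: ler_pM => //; rewrite ?(ltW D0) // (le_trans DaC).
  set e := a / C in h1 h2 *; rewrite expr2 in h2 *; lra.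
have s0 : 0 < k * (a / 2) by rewrite mulr_gt0 // divr_gt0.
apply: le_trans (chebyshev_Pq q (quad_stat w p) _ (k ^+ 2 * A) (k * (a / 2)) hq s0 _) _.
  move=> x; rewrite -leNgt => h.
  rewrite distrC; apply: le_trans (ler_norm _); rewrite lerBrDr.
  have KD : K * D <= a / 2.
    have : 2 * (K * D) <= C ^+ 2 * D by rewrite mulrA ler_wpM2r // ltW.
    lra.
  have -> : k ^+ 2 * A = k * (a / 2) + k * (a / 2) by rewrite /a; field.
  rewrite lerD2l; apply: le_trans h _.
  by rewrite -mulrA mulrCA ler_wpM2l // ltW.
rewrite ler_pdivrMr ?exprn_gt0 //; apply: le_trans hv _.
have -> : 32 / C * (k * (a / 2)) ^+ 2 = k ^+ 2 * (8 * (a / C) * a).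
  by field; rewrite gt_eqF.
by rewrite ler_wpM2l ?sqr_ge0 //; apply: le_trans var varC.
Qed.

End Statistics.

(** * Components of the rate *)

Section Rates.
Context {R : realType}.
Implicit Types (x y t s : R).

Lemma powR_expR x y : expR x `^ y = expR (y * x).
Proof. by rewrite /powR gt_eqF ?expR_gt0 // expRK. Qed.

(* Up to a constant, this and [sum_interp] stand in for Hoelder's inequality. *)
Lemma powR_interp x y s : 0 <= x -> 0 <= y -> 0 <= s <= 1 ->
  x `^ s * y `^ (1 - s) <= x + y.
Proof.
move=> x0 y0 /andP[s0 s1].
wlog xy : x y s x0 y0 s0 s1 / x <= y.
  move=> h; have [xy|/ltW yx] := leP x y; first exact: h.
  have := h y x (1 - s) y0 x0; rewrite subr_ge0 gerBl s0 s1 subKr => h'.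
  by rewrite mulrC [leRHS]addrC h'.
apply: (@le_trans _ _ (y `^ s * y `^ (1 - s))).
  by rewrite ler_wpM2r ?powR_ge0 // ge0_ler_powR ?nnegrE.
rewrite -powRD; last by rewrite addrC subrK oner_eq0.
by rewrite addrC subrK powRr1 // lerDr.
Qed.

Lemma powR_add_le x y s : 0 <= x -> 0 <= y -> 0 <= s <= 1 ->
  (x + y) `^ s <= 2 * (x `^ s + y `^ s).
Proof.
move=> x0 y0 /andP[s0 s1].
wlog xy : x y x0 y0 / x <= y.
  move=> h; have [xy|/ltW yx] := leP x y; first exact: h.
  by rewrite addrC [X in _ * X]addrC; apply: h.
have y2 : (x + y) `^ s <= (2 * y) `^ s.
  by rewrite ge0_ler_powR ?nnegrE ?addr_ge0 // ?mulr_ge0 // mulr_natl mulr2n lerD2r.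
apply: le_trans y2 _; rewrite powRM //.
apply: ler_pM; rewrite ?powR_ge0 //; first by apply: ler1_powR => //; lra.
by rewrite lerDr powR_ge0.
Qed.

Lemma ler_powR2 x y s : 0 <= s -> 0 <= x -> x <= y -> x `^ s <= y `^ s.
Proof.
by move=> s0 x0 xy; rewrite ge0_ler_powR // nnegrE // (le_trans x0).
Qed.

(** The first two terms of the rate as functions of the bare sums of [p j ^ r] and of [p j], which
    makes monotonicity available; the power [r^-1] restores the norm. *)
Definition bulk_rate (n : nat) t x : R := Num.sqrt (x `^ (r_exp t)^-1 / n%:R).
Definition tail_rate (n : nat) t x : R :=
  x `^ ((2 - t) / t) / n%:R `^ ((2 * t - 2) / t).

Lemma r_exp_gt0 t : 1 <= t <= 2 -> 0 < r_exp t.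
Proof. by move=> ht; rewrite /r_exp divr_gt0 //; lra. Qed.

Lemma bulk_rateE n t x : bulk_rate n t x = (x `^ (r_exp t)^-1 / n%:R) `^ 2^-1.
Proof. by rewrite powR12_sqrt // divr_ge0 ?powR_ge0. Qed.

Lemma le_bulk_rate n t x y : 1 <= t <= 2 -> 0 <= x -> x <= y ->
  bulk_rate n t x <= bulk_rate n t y.
Proof.
move=> ht x0 xy; rewrite ler_wsqrtr // ler_wpM2r ?invr_ge0 // ler_powR2 //.
by rewrite invr_ge0 ltW // r_exp_gt0.
Qed.

Lemma le_tail_rate n t x y : 1 <= t <= 2 -> 0 <= x -> x <= y ->
  tail_rate n t x <= tail_rate n t y.
Proof.
move=> ht x0 xy; rewrite ler_wpM2r ?invr_ge0 ?powR_ge0 // ler_powR2 //.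
by rewrite divr_ge0 //; lra.
Qed.

(** The tests and priors control sums of [t]-th powers, so the rates are compared with them in this
    form. *)
Lemma bulk_rate_powR n t x : 1 <= t <= 2 -> 
  bulk_rate n t x `^ t = x `^ (1 - t / 4) / n%:R `^ (t / 2).
Proof.
move=> ht; rewrite bulk_rateE powRM ?powR_ge0 ?invr_ge0 // powRM ?powR_ge0 //.
rewrite -!powRrM -(@powR_inv1 _ n%:R) // -powRrM -powRN; congr (_ `^ _ * _ `^ _).
  by rewrite /r_exp; field; rewrite !gt_eqF //; lra.
by field.
Qed.

Lemma tail_rate_powR n t x : 1 <= t <= 2 -> 
  tail_rate n t x `^ t = x `^ (2 - t) / n%:R `^ (2 * t - 2).
Proof.
move=> ht; rewrite /tail_rate powRM ?powR_ge0 ?invr_ge0 ?powR_ge0 //.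
rewrite -powRN -!powRrM -powRN; congr (_ `^ _ * _ `^ _);
  by field; rewrite gt_eqF //; lra.
Qed.

Lemma rateE N n (cI t : R) (p : vec R N) : 1 <= t <= 2 -> standing p ->
  let I := Iidx n cI p in
  rate n cI t p = bulk_rate n t (\sum_(j < N | (j < I)%N) p j `^ r_exp t)
    + tail_rate n t (\sum_(j < N | (I <= j)%N) p j) + 1 / n%:R.
Proof.
move=> ht [p01 _] I; rewrite /rate -/I /lpnorm /trunc_le /trunc_gt.
have p0 j : 0 <= p j by have /andP[] := p01 j.
(* Since [0^0 = 1] for real powers, the truncated coordinates only drop out because the exponent is
   nonzero. *)
have r0 : r_exp t != 0 by rewrite gt_eqF // r_exp_gt0.
have -> : \sum_(j < N) `|if (j < I)%N then p j else 0| `^ r_exp t =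
   \sum_(j < N | (j < I)%N) p j `^ r_exp t.
  rewrite [RHS]big_mkcond; apply: eq_bigr => j _; case: ifP => _.
    by rewrite ger0_norm.
  by rewrite normr0 powR0.
have -> : \sum_(j < N) `|if (I <= j)%N then p j else 0| `^ 1 =
   \sum_(j < N | (I <= j)%N) p j.
  rewrite [RHS]big_mkcond; apply: eq_bigr => j _; case: ifP => _.
    by rewrite ger0_norm // powRr1.
  by rewrite normr0 powR0 ?oner_eq0.
by rewrite invr1 powRr1 // sumr_ge0.
Qed.

(** This is the bulk rate of [I] coordinates all equal to [1 / (n sqrt I)]. *)
Definition mesh (n I : nat) t : R := I%:R `^ ((2 - t) / (2 * t)) / n%:R.

(** One summand for each of the two cases in [mesh_le]. *)
Definition mesh_cst cI t : R :=
  ((cI / 2) `^ 4^-1)^-1 + ((cI / 2) `^ ((2 - t) / (2 * t)))^-1.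

Lemma mesh_cst_gt0 cI t : 0 < cI -> 0 < mesh_cst cI t.
Proof. by move=> c0; rewrite addr_gt0 // invr_gt0 powR_gt0 // divr_gt0. Qed.

(** Here [a] stands for the smallest bulk coordinate, and the last hypothesis is what minimality of
    the split index yields. With [d = cI / 2], either [a >= sqrt d / (n sqrt I)] and the bulk rate
    dominates the mesh, or [M >= sqrt (d I) / n] and the tail rate does. *)
Lemma mesh_le (n I : nat) (cI t a S M : R) : 1 <= t <= 2 -> 0 < cI ->
  (0 < n)%N -> (0 < I)%N -> 0 < a -> I%:R * a `^ r_exp t <= S ->
  cI / n%:R ^+ 2 < a ^+ 2 + a * M ->
  mesh n I t <= mesh_cst cI t * (bulk_rate n t S + tail_rate n t M).
Proof.
move=> ht cI0 n0 I0 a0 hS hM.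
have B0 : 0 <= bulk_rate n t S by rewrite sqrtr_ge0.
have T0 : 0 <= tail_rate n t M by rewrite divr_ge0 ?powR_ge0.
have nn0 : 0 < n%:R :> R by rewrite ltr0n.
have ii0 : 0 < I%:R :> R by rewrite ltr0n.
have d0 : 0 < cI / 2 by rewrite divr_gt0.
have r0 := r_exp_gt0 t ht.
set d := cI / 2 in d0 *.
have e1 : 0 < d `^ 4^-1 by rewrite powR_gt0.
have e2 : 0 < d `^ ((2 - t) / (2 * t)) by rewrite powR_gt0.
suff [h|h] : d `^ 4^-1 * mesh n I t <= bulk_rate n t S \/
    d `^ ((2 - t) / (2 * t)) * mesh n I t <= tail_rate n t M.
- rewrite -ler_pdivlMl // in h; apply: le_trans h _.
  apply: ler_pM; rewrite ?invr_ge0 ?(ltW e1) // /mesh_cst ?lerDl //.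
  by rewrite invr_ge0 ltW.
- rewrite -ler_pdivlMl // in h; apply: le_trans h _.
  apply: ler_pM; rewrite ?invr_ge0 ?(ltW e2) // /mesh_cst ?lerDr //.
  by rewrite invr_ge0 ltW.
(* Positive quantities are written as exponentials, so that identities between real powers become
   linear identities in the exponents. *)
have lnE (z : R) : 0 < z -> {Z | z = expR Z} by exists (ln z); rewrite lnK.
have [X dE] := lnE _ d0; have [Y nE] := lnE _ nn0; have [Z iE] := lnE _ ii0.
(* If [sc <= a] the bulk sum is large; otherwise [a M] exceeds [d / n^2] and
   the tail sum [M] is large. *)
pose sc : R := expR (2^-1 * X - Y - 2^-1 * Z).
have sc2 : sc ^+ 2 = d / (n%:R ^+ 2 * I%:R).
  rewrite dE nE iE -!expRM_natl -expRD -expRN -expRD; congr expR.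
  by field.
have t0 : 0 < t by lra.
have [sa|as_] := leP sc a; [left|right].
  apply: le_trans (le_bulk_rate n t (I%:R * sc `^ r_exp t) S ht _ _).
  - rewrite le_eqVlt; apply/orP; left; apply/eqP.
    rewrite bulk_rateE /mesh dE nE iE /sc.
    rewrite !powR_expR -?expRN -?expRD !powR_expR -?expRN -?expRD powR_expR.
    by congr expR; rewrite /r_exp; field; rewrite !gt_eqF //; lra.
  - by rewrite mulr_ge0 ?powR_ge0.
  - apply: le_trans hS; rewrite ler_wpM2l // ler_powR2 ?expR_ge0 // ltW //.
have aM : d / n%:R ^+ 2 <= a * M.
  have : a ^+ 2 <= d / n%:R ^+ 2.
    apply: (@le_trans _ _ (sc ^+ 2)).
      by rewrite lerXn2r ?nnegrE ?expR_ge0 // ltW.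
    rewrite sc2 ler_wpM2l ?(ltW d0) // lef_pV2 ?posrE ?mulr_gt0 ?exprn_gt0 //.
    by rewrite ler_peMr ?sqr_ge0 // ler1n.
  move: hM; have -> : cI / n%:R ^+ 2 = d / n%:R ^+ 2 + d / n%:R ^+ 2.
    by rewrite /d; field; rewrite gt_eqF.
  by set z := d / _; lra.
have sM : d / n%:R ^+ 2 / sc <= M.
  rewrite ler_pdivrMr ?expR_gt0 // [leRHS]mulrC; apply: le_trans (aM) _.
  rewrite ler_wpM2r ?(ltW as_) //.
  rewrite leNgt; apply/negP => M0; have : a * M < 0 by rewrite pmulr_rlt0.
  by move=> /(le_lt_trans aM); rewrite ltNge divr_ge0 // ltW // exprn_gt0.
apply: le_trans (le_tail_rate n t (d / n%:R ^+ 2 / sc) M ht _ sM); last first.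
  by rewrite !divr_ge0 ?expR_ge0 ?exprn_ge0 // ltW.
rewrite le_eqVlt; apply/orP; left; apply/eqP.
rewrite /tail_rate /mesh dE nE iE /sc -expRM_natl.
rewrite !powR_expR -?expRN -?expRD !powR_expR -?expRN -?expRD.
by congr expR; field; rewrite !gt_eqF //; lra.
Qed.

End Rates.

(** * Upper bound *)

Section SplitIndex.
Context {R : realType} {N n : nat}.
Implicit Types (p q : vec R N) (t cI : R).

Lemma tail_sq_last p : tail_sq p N = 0.
Proof. by rewrite /tail_sq big1 // => i; rewrite leqNgt ltn_ord. Qed.

Lemma Iidx_spec cI p : 0 < cI -> let I := Iidx n cI p in
  [/\ (I <= N)%N, tail_sq p I <= cI / n%:R ^+ 2 &
   (0 < I)%N -> cI / n%:R ^+ 2 < tail_sq p I.-1].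
Proof.
move=> cI0; rewrite /Iidx.
set P := fun J => tail_sq p J <= cI / n%:R ^+ 2; set I := find P _ => /=.
(* [J = N] always qualifies, its tail being empty, so [find] never runs past the list. *)
have hP : has P (iota 0 N.+1).
  apply/hasP; exists N; first by rewrite mem_iota leq0n add0n ltnSn.
  by rewrite /P tail_sq_last divr_ge0 ?exprn_ge0 // ltW.
have IN : (I < N.+1)%N by move: hP; rewrite has_find size_iota.
split => //.
  by have := nth_find 0%N hP; rewrite nth_iota // add0n.
move=> I0; have I1 : (I.-1 < I)%N by rewrite prednK.
have := before_find 0%N I1; rewrite nth_iota ?add0n; last by rewrite (ltn_trans I1).
by move=> /negbT; rewrite -ltNge.
Qed.

Lemma sum_ord_lt_const (I : nat) (c : R) : (I <= N)%N ->
  \sum_(j < N | (j < I)%N) c = I%:R * c.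
Proof. by move=> IN; rewrite (big_ord_narrow IN) sumr_const card_ord mulr_natl. Qed.

Definition bulk_sum (I : nat) t p : R := \sum_(j < N | (j < I)%N) p j `^ r_exp t.
Definition tail_sum (I : nat) p : R := \sum_(j < N | (I <= j)%N) p j.

Lemma bulk_sum_ge0 I t p : 0 <= bulk_sum I t p.
Proof. by apply: sumr_ge0 => j _; apply: powR_ge0. Qed.

Lemma tail_sum_ge0 I p : standing p -> 0 <= tail_sum I p.
Proof. by move=> [p01 _]; apply: sumr_ge0 => j _; have /andP[] := p01 j. Qed.

(** The witness is the last bulk coordinate. By monotonicity each tail term satisfies
    [p j ^ 2 <= a p j], and the strict inequality just before [I] forces [a > 0]. *)
Lemma Iidx_boundary cI p (I0 : (0 < Iidx n cI p)%N) : 0 < cI -> standing p ->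
  exists a : R, [/\ 0 < a, forall j : 'I_N, (j < Iidx n cI p)%N -> a <= p j &
    cI / n%:R ^+ 2 < a ^+ 2 + a * tail_sum (Iidx n cI p) p].
Proof.
move=> cI0 [p01 [pmon _]]; have [] := Iidx_spec cI p cI0.
set I := Iidx n cI p in I0 * => IN _ /(_ I0) hI.
have I1N : (I.-1 < N)%N by rewrite prednK.
(* Indices start at 0, so the last bulk coordinate is [I.-1]. *)
pose i := Ordinal I1N.
have pi0 : 0 <= p i by have /andP[] := p01 i.
have hI' : cI / n%:R ^+ 2 < p i ^+ 2 + p i * tail_sum I p.
  apply: lt_le_trans hI _; rewrite /tail_sq (bigD1 i) //= lerD2l.
  rewrite /tail_sum mulr_sumr big_mkcond [leRHS]big_mkcond /=.
  apply: ler_sum => j _.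
  have -> : (I.-1 <= j)%N && (j != i) = (I <= j)%N.
    by rewrite -val_eqE /= [(j : nat) == _]eq_sym andbC -ltn_neqAle prednK.
  case: ifP => // Ij; have /andP[pj _] := p01 j.
  by rewrite expr2 ler_wpM2r // pmon //= (leq_trans (leq_pred _)).
exists (p i); split => //.
  rewrite lt_neqAle pi0 andbT; apply/negP => /eqP p0; move: hI'.
  by rewrite -p0 expr0n mul0r addr0 ltNge divr_ge0 ?sqr_ge0 // ltW.
by move=> j jI; apply: pmon; rewrite /= -ltnS prednK.
Qed.

Lemma mesh_le_rates t cI p : 1 <= t <= 2 -> 0 < cI -> (0 < n)%N -> standing p ->
  let I := Iidx n cI p in (0 < I)%N ->
  mesh n I t <= mesh_cst cI t *
    (bulk_rate n t (bulk_sum I t p) + tail_rate n t (tail_sum I p)).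
Proof.
move=> ht cI0 n0 sp I I0; have [a [a0 ap ha]] := Iidx_boundary cI p I0 cI0 sp.
have [IN _ _] := Iidx_spec cI p cI0.
apply: (mesh_le n I cI t a) => //.
rewrite -(sum_ord_lt_const I _ IN); apply: ler_sum => j jI.
by apply: ler_powR2; rewrite ?(ltW a0) ?(ltW (r_exp_gt0 t ht)) // ap.
Qed.

End SplitIndex.

(** * Tests for the bulk and for the tail *)

Section UpperBound.
Context {R : realType}.
Implicit Types (eta t cI : R).

(** Divide [x] by [A] and [y] by [V] and apply [powR_interp] termwise; each normalised sum is at
    most 1, hence the factor 2. *)
Lemma sum_interp (T : finType) (P : pred T) (a x y : T -> R) (A V s : R) :
  0 <= s <= 1 -> 0 < A -> 0 < V ->
  (forall j, P j -> [/\ 0 <= x j, 0 <= y j & a j <= x j `^ s * y j `^ (1 - s)]) ->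
  \sum_(j | P j) x j <= A -> \sum_(j | P j) y j <= V ->
  \sum_(j | P j) a j <= 2 * (A `^ s * V `^ (1 - s)).
Proof.
move=> hs A0 V0 h hA hV.
have c0 : 0 < A `^ s * V `^ (1 - s) by rewrite mulr_gt0 ?powR_gt0.
apply: (@le_trans _ _ (\sum_(j | P j) A `^ s * V `^ (1 - s) * (x j / A + y j / V))).
  apply: ler_sum => j Pj; have [x0 y0 axy] := h j Pj; apply: le_trans axy _.
  rewrite -{1}(@divfK _ A _ (x j)) ?gt_eqF // -{1}(@divfK _ V _ (y j)) ?gt_eqF //.
  have xA : 0 <= x j / A by rewrite divr_ge0 // ltW.
  have yV : 0 <= y j / V by rewrite divr_ge0 // ltW.
  rewrite (powRM _ xA) ?(ltW A0) // (powRM _ yV) ?(ltW V0) //.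
  rewrite mulrACA mulrC ler_wpM2l ?(ltW c0) //.
  exact: powR_interp.
rewrite -mulr_sumr big_split /= -!mulr_suml mulrC ler_wpM2r ?(ltW c0) //.
have h1 : (\sum_(i | P i) x i) / A <= 1 by rewrite ler_pdivrMr // mul1r.
have h2 : (\sum_(i | P i) y i) / V <= 1 by rewrite ler_pdivrMr // mul1r.
lra.
Qed.

(** If the statistic cannot detect [q], then the sum of [v j ^ (- b) (q j - p j)^2] is below a
    multiple of [sqrt V / k], where [V] sums [v j ^ r]. Interpolation with [V] bounds the [t]-th
    power sum by a multiple of [V^(1 - t / 4) / k^(t / 2)], hence of the rate to the power [t]. *)
Lemma bulk_test eta t cI : 0 < eta < 1 -> 1 <= t <= 2 -> 0 < cI ->
  exists2 C : R, 0 < C & forall (N n : nat) (p : vec R N),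
    (2 <= n)%N -> ~~ odd n -> standing p ->
    exists psi : test N n, Pq p psi <= eta / 6 /\
      forall q, in_cube q ->
      C * rate n cI t p `^ t
        <= \sum_(j < N | (j < Iidx n cI p)%N) `|p j - q j| `^ t ->
      Pq q (fun x => ~~ psi x) <= eta / 2.
Proof.
move=> /andP[eta0 eta1] ht cI0; have /andP[t1 t2] := ht.
have t0 : 0 <= t by lra.
have t4 : 4 - t != 0 by rewrite gt_eqF //; lra.
have ht2 : 0 <= t / 2 <= 1 by lra.
have ht4 : 0 <= 1 - t / 4 <= 1 by lra.
(* [H] makes the false alarm [H^-2] at most [eta / 6], and [C0 = 2 H] makes the missed detection
   [32 / C0 = eta / 4]. *)
pose H := 64 / eta.
have H64 : 64 <= H by rewrite ler_pdivlMr //; lra.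
have H1 : 1 <= H by lra.
have H6 : 6 / eta <= H by rewrite /H ler_pM2r ?invr_gt0 //; lra.
pose C0 := 2 * H.
have C00 : 0 < C0 by rewrite /C0; lra.
have C01 : 1 <= C0 by rewrite /C0; lra.
have HC0 : 2 * H <= C0 ^+ 2 by rewrite /C0; nra.
have m0 := mesh_cst_gt0 cI t cI0.
(* The 4 collects the factors 2 of [sum_interp] and [powR_add_le]; the bracket has one term for the
   bulk sum and one for the floor; the final 1 makes the comparison strict. *)
pose C := 4 * C0 `^ t * (2 `^ (t / 2) + (2 * mesh_cst cI t) `^ t) + 1.
have C1 : 0 < C.
  by rewrite /C ltr_wpDl // !mulr_ge0 ?addr_ge0 ?powR_ge0.
exists C => // N n p n2 nev sp.
have n0 : (0 < n)%N by apply: ltn_trans n2.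
have [p01 [pmon _]] := sp.
have [IN _ _] := Iidx_spec (n:=n) cI p cI0.
have rpos : 0 < rate n cI t p.
  rewrite rateE // ltr_wpDl ?addr_ge0 ?sqrtr_ge0 ?divr_ge0 ?powR_ge0 //.
  by rewrite ?divr_gt0 ?ltr0n.
(* With an empty bulk no [q] meets the separation condition, so never rejecting is enough. *)
case: (posnP (Iidx n cI p)) => [I0|I0].
  exists (fun _ => false); split.
    by rewrite /Pq big_pred0_eq divr_ge0 // ltW.
  move=> q hq; rewrite big_pred0; last by move=> j; rewrite I0.
  by rewrite leNgt mulr_gt0 ?powR_gt0.
have hmesh := mesh_le_rates t cI p ht cI0 n0 sp I0.
set I := Iidx n cI p in I0 IN hmesh *.
pose k : R := n./2%:R.
have k0 : 0 < k := natr_half_gt0 n2.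
have nk : n%:R = 2 * k.
  by rewrite /k -{1}(even_halfK nev) -muln2 natrM mulrC.
have r0 := r_exp_gt0 t ht.
pose r := r_exp t; pose b := 1 - r / 2.
have rE : r * (4 - t) = 2 * t by rewrite /r /r_exp divfK // gt_eqF //; lra.
have b0 : 0 <= b.
  have : r <= 2 by rewrite /r /r_exp ler_pdivrMr; lra.
  by rewrite /b; lra.
have i0 : 0 < I%:R :> R by rewrite ltr0n.
have lnE (z : R) : 0 < z -> {Z | z = expR Z} by exists (ln z); rewrite lnK.
have [X kE] := lnE _ k0; have [Y iE] := lnE _ i0.
(* This is [1 / (k sqrt I)]. *)
pose tau := expR (- X - Y / 2).
have tau0 : 0 < tau := expR_gt0 _.
pose v (j : 'I_N) := Num.max (p j) tau.
have vtau j : tau <= v j by rewrite le_max lexx orbT.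
have vp j : p j <= v j by rewrite le_max lexx.
have v0 j : 0 < v j by exact: lt_le_trans tau0 (vtau j).
have p0 j : 0 <= p j by have /andP[] := p01 j.
pose V := \sum_(j < N | (j < I)%N) v j `^ r.
have V_ge : I%:R * tau `^ r <= V.
  rewrite -(sum_ord_lt_const I _ IN); apply: ler_sum => j _.
  by apply: ler_powR2; rewrite ?(ltW tau0) // ltW.
have V0 : 0 < V.
  by apply: lt_le_trans V_ge; rewrite mulr_gt0 // powR_gt0.
have V_le : V <= bulk_sum I t p + I%:R * tau `^ r.
  rewrite -(sum_ord_lt_const I _ IN) -big_split; apply: ler_sum => j _ /=.
  rewrite /v /r; case: (leP (p j) tau) => _; last by rewrite lerDl powR_ge0.
  by rewrite lerDr powR_ge0.
pose D := V `^ 2^-1.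
have D0 : 0 < D by rewrite powR_gt0.
have D2 : D ^+ 2 = V by rewrite /D powR12_sqrt ?sqr_sqrtr ?ltW.
pose w (j : 'I_N) := if (j < I)%N then v j `^ (- b) else 0.
have sumw f : \sum_j w j * f j = \sum_(j < N | (j < I)%N) v j `^ (- b) * f j.
  rewrite [RHS]big_mkcond; apply: eq_bigr => j _; rewrite /w.
  by case: ifP => _ //; rewrite mul0r.
have hw j : 0 <= w j <= k * D.
  rewrite /w; case: ifP => _; last by rewrite lexx mulr_ge0 // ltW.
  rewrite powR_ge0 /=; apply: (@le_trans _ _ (tau `^ (- b))).
    rewrite !powRN lef_pV2 ?posrE ?powR_gt0 //.
    by apply: ler_powR2; rewrite ?(ltW tau0).
  apply: (@le_trans _ _ (k * (I%:R * tau `^ r) `^ 2^-1)).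
    (* The choice of [tau] makes this an equality: [tau^(- b) = k (I tau^r)^(1 / 2)]. *)
    rewrite kE iE /tau !powR_expR -?expRD !powR_expR -?expRD le_eqVlt.
    by apply/orP; left; apply/eqP; congr expR; rewrite /b; field.
  rewrite ler_wpM2l ?(ltW k0) // ler_powR2 // mulr_ge0 ?powR_ge0 //.
have hwD : \sum_j w j ^+ 2 * p j ^+ 2 <= D ^+ 2.
  rewrite D2 /V [leRHS]big_mkcond; apply: ler_sum => j _ /=.
  rewrite /w; case: ifP => _; last by rewrite expr0n mul0r.
  apply: (@le_trans _ _ ((v j `^ (- b)) ^+ 2 * v j ^+ 2)).
    by rewrite ler_wpM2l ?sqr_ge0 // lerXn2r ?nnegrE // ltW.
  have [Z ->] := lnE _ (v0 j).
  rewrite !powR_expR -!expRM_natl -expRD le_eqVlt; apply/orP; left; apply/eqP.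
  by congr expR; rewrite /b; field.
have K0 : 0 < H := lt_le_trans ltr01 H1.
exists (fun x => H * k * D < quad_stat w p x); split.
  apply: le_trans (quad_stat_null nev n2 w p D H p01 D0 K0 hwD) _.
  have -> : eta / 6 = (6 / eta)^-1 by rewrite invf_div.
  rewrite lef_pV2 ?posrE ?exprn_gt0 ?divr_gt0 //.
  by apply: le_trans H6 _; rewrite expr2 ler_peMr // ltW.
move=> q hq hbig.
apply: le_trans (quad_stat_alt nev n2 w p q D H C0 p01 hq D0 C01 HC0 hw hwD _) _.
- rewrite leNgt; apply/negP => small.
  pose A := C0 ^+ 2 * D / k.
  have A0 : 0 < A by rewrite divr_gt0 // mulr_gt0 // exprn_gt0.
  have hA : \sum_(j < N | (j < I)%N) v j `^ (- b) * (q j - p j) ^+ 2 <= A.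
    by rewrite -sumw /A ler_pdivlMr // mulrC ltW.
  have := sum_interp _ (fun j : 'I_N => (j < I)%N) (fun j => `|p j - q j| `^ t)
    _ (fun j => v j `^ r) A V (t / 2) ht2 A0 V0 _ hA (lexx V).
  have Pj (j : 'I_N) : (j < I)%N -> [/\ 0 <= v j `^ (- b) * (q j - p j) ^+ 2,
      0 <= v j `^ r & `|p j - q j| `^ t
       <= (v j `^ (- b) * (q j - p j) ^+ 2) `^ (t / 2) * (v j `^ r) `^ (1 - t / 2)].
    move=> _; split; [by rewrite mulr_ge0 ?powR_ge0 ?sqr_ge0|exact: powR_ge0|].
    rewrite powRM ?powR_ge0 ?sqr_ge0 // -[(q j - p j) ^+ 2]real_normK ?num_real //.
    rewrite -powR_mulrn // -!powRrM mulrAC distrC.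
    have -> : 2%:R * (t / 2) = t by field.
    have [Z ->] := lnE _ (v0 j).
    rewrite !powR_expR -expRD.
    (* The powers of [v j] cancel: [b t / 2 = r (1 - t / 2)], equivalent to [r (4 - t) = 2 t]. *)
    have -> : - b * (t / 2) * Z + r * (1 - t / 2) * Z = 0.
      have -> : - b * (t / 2) * Z + r * (1 - t / 2) * Z
         = (r * (4 - t) - 2 * t) / 4 * Z by rewrite /b; field.
      by rewrite rE subrr mul0r mul0r.
    by rewrite expR0 mul1r.
  move=> /(_ Pj) /(le_trans hbig) {Pj}; rewrite leNgt => /negP; apply.
  set Bt := bulk_rate n t (bulk_sum I t p) in hmesh.
  set Mt := tail_rate n t (tail_sum I p) in hmesh.
  have Bt0 : 0 <= Bt by rewrite sqrtr_ge0.
  have Mt0 : 0 <= Mt by rewrite divr_ge0 ?powR_ge0.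
  have ratE : rate n cI t p = Bt + Mt + 1 / n%:R by rewrite rateE.
  have n10 : 0 < 1 / n%:R :> R by rewrite divr_gt0 ?ltr0n.
  have BMr : Bt + Mt <= rate n cI t p by rewrite ratE lerDl ltW.
  have Br : Bt <= rate n cI t p by apply: le_trans BMr; rewrite lerDl.
  have B1 : bulk_sum I t p `^ (1 - t / 4) / k `^ (t / 2)
      <= 2 `^ (t / 2) * rate n cI t p `^ t.
    apply: (@le_trans _ _ (2 `^ (t / 2) * Bt `^ t)).
      rewrite bulk_rate_powR // nk powRM ?(ltW k0) // le_eqVlt; apply/orP; left.
      by apply/eqP; field; rewrite !gt_eqF ?powR_gt0.
    by rewrite ler_wpM2l ?powR_ge0 // ler_powR2.
  (* The contribution of the floor equals [(2 mesh)^t], which [mesh_le_rates] absorbs into the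
     rate. *)
  have B2 : (I%:R * tau `^ r) `^ (1 - t / 4) / k `^ (t / 2)
      <= (2 * mesh_cst cI t) `^ t * rate n cI t p `^ t.
    apply: (@le_trans _ _ ((2 * mesh n I t) `^ t)).
      rewrite /mesh nk kE iE /tau !powR_expR -?expRN -?expRD !powR_expR -?expRD.
      have -> (z : R) : 2 * (z / (2 * expR X)) = z * expR (- X).
        by rewrite expRN; field; rewrite gt_eqF ?expR_gt0.
      rewrite -expRD powR_expR le_eqVlt; apply/orP; left; apply/eqP; congr expR.
      have re : r = 2 * t / (4 - t) by [].
      by rewrite re; field; rewrite t4 gt_eqF // (lt_le_trans ltr01).
    rewrite -powRM ?(ltW rpos) // ?mulr_ge0 ?(ltW m0) // ler_powR2 //.
      by rewrite mulr_ge0 // divr_ge0 ?powR_ge0.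
    rewrite -mulrA ler_wpM2l //; apply: le_trans hmesh _.
    by rewrite ler_wpM2l // ltW.
  have V1 : V `^ (1 - t / 4) / k `^ (t / 2) <= 2 *
      ((2 `^ (t / 2) + (2 * mesh_cst cI t) `^ t) * rate n cI t p `^ t).
    apply: (@le_trans _ _ (2 * (bulk_sum I t p `^ (1 - t / 4) +
        (I%:R * tau `^ r) `^ (1 - t / 4)) / k `^ (t / 2))).
      rewrite ler_wpM2r ?invr_ge0 ?powR_ge0 //.
      apply: (@le_trans _ _ ((bulk_sum I t p + I%:R * tau `^ r) `^ (1 - t / 4))).
        by apply: ler_powR2; [case/andP: ht4|exact: ltW|].
      by apply: powR_add_le; rewrite ?bulk_sum_ge0 ?mulr_ge0 ?powR_ge0.
    rewrite -mulrA ler_wpM2l // [leLHS]mulrDl [leRHS]mulrDl; exact: lerD.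
  have -> : A `^ (t / 2) * V `^ (1 - t / 2)
      = C0 `^ t * (V `^ (1 - t / 4) / k `^ (t / 2)).
    rewrite /A /D kE; have [Z ->] := lnE _ V0; have [Z' ->] := lnE _ C00.
    rewrite -!expRM_natl !powR_expR -?expRN -?expRD !powR_expR -?expRD.
    by congr expR; field.
  have RT : 0 < rate n cI t p `^ t by rewrite powR_gt0.
  apply: (@le_lt_trans _ _ (2 * (C0 `^ t * (2 *
      ((2 `^ (t / 2) + (2 * mesh_cst cI t) `^ t) * rate n cI t p `^ t))))).
    by rewrite ler_wpM2l // ler_wpM2l ?powR_ge0.
  rewrite /C mulrDl mul1r -subr_gt0.
  set z := rate n cI t p `^ t in RT *; apply: (lt_le_trans RT).
  by rewrite le_eqVlt; apply/orP; left; apply/eqP; ring.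
- rewrite /C0 /H; have -> : 32 / (2 * (64 / eta)) = eta / 4.
    by field; rewrite gt_eqF.
  by rewrite ler_pM2l // lef_pV2 ?posrE // ler_nat.
Qed.

(** Write [|d|^t = |d|^(2 - t) (d^2)^(t - 1)]. The total count controls the sum of [|d|] and the
    quadratic statistic with unit weights that of [d^2]; if neither detects [q], interpolation keeps
    the sum of [|d|^t] below the rate. *)
Lemma tail_test eta t cI : 0 < eta < 1 -> 1 <= t <= 2 -> 0 < cI ->
  exists2 C : R, 0 < C & forall (N n : nat) (p : vec R N),
    (2 <= n)%N -> ~~ odd n -> standing p ->
    exists psi : test N n, Pq p psi <= eta / 3 /\
      forall q, in_cube q ->
      C * rate n cI t p `^ t
        <= \sum_(j < N | (Iidx n cI p <= j)%N) `|p j - q j| `^ t ->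
      Pq q (fun x => ~~ psi x) <= eta / 2.
Proof.
move=> /andP[eta0 eta1] ht cI0; have /andP[t1 t2] := ht.
pose H := 64 / eta.
have H64 : 64 <= H by rewrite ler_pdivlMr //; lra.
have H0 : 0 < H by lra.
have H1 : 1 <= H by lra.
have H6 : 6 / eta <= H by rewrite /H ler_pM2r ?invr_gt0 //; lra.
have t0 : 0 < t by lra.
have hs : 0 <= 2 - t <= 1 by lra.
pose C0 := 2 * H.
have C00 : 0 < C0 by rewrite /C0; lra.
have C01 : 1 <= C0 by rewrite /C0; lra.
have HC0 : 2 * H <= C0 ^+ 2 by rewrite /C0; nra.
(* [G] and [E] are the constants in the bounds [hx] and [hy] on the sums of [|p j - q j|] and of its
   square. *)
pose G := 2 * H + 1; pose E := 2 * C0 ^+ 2 * (2 + cI).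
have G0 : 0 < G by rewrite /G; lra.
have cI2 : 0 < 2 + cI by lra.
have E0 : 0 < E by rewrite mulr_gt0 // mulr_gt0 // exprn_gt0.
pose C := 8 * (G `^ (2 - t) * E `^ (t - 1)) + 1.
exists C => [|N n p n2 nev sp].
  by rewrite /C ltr_wpDl // !mulr_ge0 ?powR_ge0.
have n0 : (0 < n)%N by apply: ltn_trans n2.
have nn0 : 0 < n%:R :> R by rewrite ltr0n.
have [p01 [pmon _]] := sp.
have p0 j : 0 <= p j by have /andP[] := p01 j.
have [IN hI _] := Iidx_spec (n:=n) cI p cI0.
set I := Iidx n cI p in IN hI *.
have ratE : rate n cI t p = bulk_rate n t (bulk_sum I t p)
  + tail_rate n t (tail_sum I p) + 1 / n%:R by rewrite rateE.
pose M := tail_sum I p; have M0 : 0 <= M := tail_sum_ge0 I p sp.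
pose k : R := n./2%:R.
have k0 : 0 < k := natr_half_gt0 n2.
have nk : n%:R = 2 * k.
  by rewrite /k -{1}(even_halfK nev) -muln2 natrM mulrC.
(* The summand 2 gives [k D >= 1], so unit weights respect the cap of [quad_stat_alt]; also
   [cI <= (2 + cI)^2] covers the tail sum of squares. *)
pose D := (2 + cI) / n%:R.
have D0 : 0 < D by rewrite divr_gt0 //; lra.
pose w (j : 'I_N) : R := if (I <= j)%N then 1 else 0.
have hw j : 0 <= w j <= k * D.
  have kD : k * D = (2 + cI) / 2.
    by rewrite /D nk; field; rewrite gt_eqF.
  rewrite /w kD; case: ifP => _; lra.
have sumw f : \sum_j w j * f j = \sum_(j < N | (I <= j)%N) f j.
  rewrite [RHS]big_mkcond; apply: eq_bigr => j _; rewrite /w.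
  by case: ifP => _ //; rewrite ?mul1r ?mul0r.
have hwD : \sum_j w j ^+ 2 * p j ^+ 2 <= D ^+ 2.
  rewrite (eq_bigr (fun j => w j * p j ^+ 2)); last first.
    by move=> j _; rewrite /w; case: ifP => _; rewrite ?expr1n ?expr0n.
  rewrite sumw; apply: le_trans hI _.
  rewrite /D expr_div_n ler_wpM2r ?invr_ge0 ?exprn_ge0 //; nra.
(* Under [p] the count has mean [n M], so Markov's inequality gives at most [1 / H]; the added 1
   ensures [s >= H] even for a small tail. *)
pose s := H * (n%:R * M + 1).
have nM0 : 0 <= n%:R * M by rewrite mulr_ge0.
have s0 : 0 < s by rewrite mulr_gt0 //; lra.
exists (fun x => (H * k * D < quad_stat w p x) ||
  (s <= count_stat (fun j : 'I_N => (I <= j)%N) x)); split.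
  apply: le_trans (Pq_or _ _ _ p01) _.
  have -> : eta / 3 = eta / 6 + eta / 6 by field.
  apply: lerD.
    apply: le_trans (quad_stat_null nev n2 w p D H p01 D0 H0 hwD) _.
    have -> : eta / 6 = (6 / eta)^-1 by rewrite invf_div.
    rewrite lef_pV2 ?posrE ?exprn_gt0 ?divr_gt0 //.
    by apply: le_trans H6 _; rewrite expr2 ler_peMr // ltW.
  apply: le_trans (Pq_count_stat_ge _ p s p01 s0) _.
  rewrite -/(tail_sum I p) -/M ler_pdivrMr // /s /H.
  have -> : eta / 6 * (64 / eta * (n%:R * M + 1)) = 64 / 6 * (n%:R * M + 1).
    by field; rewrite gt_eqF.
  lra.
move=> q hq hbig.
have [hA|hA] := leP (C0 ^+ 2 * D) (k * \sum_j w j * (q j - p j) ^+ 2).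
  apply: (@le_trans _ _ (Pq q (fun x => ~~ (H * k * D < quad_stat w p x)))).
    by apply: Pq_le => // x; rewrite negb_or => /andP[].
  apply: le_trans (quad_stat_alt nev n2 w p q D H C0 p01 hq D0 C01 HC0 hw hwD hA) _.
  rewrite /C0 /H; have -> : 32 / (2 * (64 / eta)) = eta / 4.
    by field; rewrite gt_eqF.
  by rewrite ler_pM2l // lef_pV2 ?posrE // ler_nat.
pose m := n%:R * \sum_(j < N | (I <= j)%N) q j.
have [hm|hm] := leP (2 * s) m.
  have m0 : 0 < m by apply: lt_le_trans hm; rewrite mulr_gt0.
  apply: (@le_trans _ _ (Pq q (fun x =>
      count_stat (fun j : 'I_N => (I <= j)%N) x < m / 2))).
    apply: Pq_le => // x; rewrite negb_or -ltNge => /andP[_].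
    by move=> h; apply: lt_le_trans h _; lra.
  apply: le_trans (Pq_count_stat_lt _ q m hq erefl m0) _.
  have Hm : 2 * H <= m.
    by apply: le_trans hm; have := mulr_ge0 (ltW H0) nM0; rewrite /s; lra.
  apply: (@le_trans _ _ (4 / (2 * H))).
    by rewrite ler_pM2l // lef_pV2 ?posrE // mulr_gt0.
  have -> : 4 / (2 * H) = eta / 32 by rewrite /H; field; rewrite gt_eqF.
  by rewrite ler_pM2l // lef_pV2 ?posrE // ler_nat.
(* Neither statistic detects [q], so both sums are small and the separation condition fails. *)
exfalso; move: hbig; apply/negP; rewrite -ltNge.
have q0 j : 0 <= q j by have /andP[] := hq j.
have nV0 : 0 < n%:R^-1 :> R by rewrite invr_gt0.
have A1 : 0 < G * (M + n%:R^-1) by rewrite mulr_gt0 // ltr_wpDl.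
have A2 : 0 < E / n%:R ^+ 2 by rewrite divr_gt0 // exprn_gt0.
have hx : \sum_(j < N | (I <= j)%N) `|p j - q j| <= G * (M + n%:R^-1).
  apply: (@le_trans _ _ (\sum_(j < N | (I <= j)%N) (p j + q j))).
    apply: ler_sum => j _.
    apply: le_trans (ler_normB _ _) _.
    by rewrite !ger0_norm.
  rewrite big_split /= -/(tail_sum I p) -/M.
  have hm' : \sum_(j < N | (I <= j)%N) q j <= 2 * H * (M + n%:R^-1).
    rewrite -(ler_pM2l nn0) -/m; apply: le_trans (ltW hm) _.
    rewrite /s le_eqVlt; apply/orP; left; apply/eqP; field.
    by rewrite gt_eqF.
  by rewrite /G; nra.
have hy : \sum_(j < N | (I <= j)%N) (q j - p j) ^+ 2 <= E / n%:R ^+ 2.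
  rewrite -sumw -(ler_pM2l k0); apply: le_trans (ltW hA) _.
  rewrite /E /D nk le_eqVlt; apply/orP; left; apply/eqP; field.
  by rewrite gt_eqF.
have Pj (j : 'I_N) : (I <= j)%N -> [/\ 0 <= `|p j - q j|,
     0 <= (q j - p j) ^+ 2 & `|p j - q j| `^ t
      <= `|p j - q j| `^ (2 - t) * ((q j - p j) ^+ 2) `^ (1 - (2 - t))].
  move=> _; split; rewrite ?sqr_ge0 //.
  rewrite -[(q j - p j) ^+ 2]real_normK ?num_real // distrC -powR_mulrn // -powRrM.
  have [->|d0] := eqVneq `|q j - p j| 0.
    by rewrite powR0 ?mulr_ge0 ?powR_ge0 // gt_eqF.
  rewrite -powRD; last by rewrite d0 implybT.
  by have -> : 2 - t + 2%:R * (1 - (2 - t)) = t by ring.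
apply: le_lt_trans (sum_interp _ _ _ _ _ _ _ (2 - t) hs A1 A2 Pj hx hy) _.
have Mr : tail_rate n t M <= rate n cI t p.
  by rewrite ratE -/M addrAC lerDr addr_ge0 ?sqrtr_ge0 // divr_ge0.
have nr : 1 / n%:R <= rate n cI t p.
  by rewrite ratE lerDr addr_ge0 ?sqrtr_ge0 // divr_ge0 ?powR_ge0.
have RT : 0 < rate n cI t p `^ t.
  by rewrite powR_gt0 // (lt_le_trans _ nr) // divr_gt0.
have B1 : M `^ (2 - t) / n%:R `^ (2 * t - 2) <= rate n cI t p `^ t.
  by rewrite -tail_rate_powR // ler_powR2 ?(ltW t0) // divr_ge0 ?powR_ge0.
have B2 : n%:R^-1 `^ (2 - t) / n%:R `^ (2 * t - 2) <= rate n cI t p `^ t.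
  apply: (@le_trans _ _ ((1 / n%:R) `^ t)); last first.
    by rewrite ler_powR2 ?(ltW t0) // divr_ge0.
  have -> : n%:R = expR (ln n%:R) :> R by rewrite lnK.
  rewrite div1r -!expRN !powR_expR -expRN -expRD le_eqVlt; apply/orP; left.
  by apply/eqP; congr expR; ring.
have -> : (G * (M + n%:R^-1)) `^ (2 - t) * (E / n%:R ^+ 2) `^ (1 - (2 - t)) =
  G `^ (2 - t) * E `^ (t - 1) * ((M + n%:R^-1) `^ (2 - t) / n%:R `^ (2 * t - 2)).
  rewrite powRM ?(ltW G0) ?addr_ge0 ?(ltW nV0) //.
  rewrite (@powRM _ E) ?(ltW E0) ?invr_ge0 ?exprn_ge0 //.
  have -> : 1 - (2 - t) = t - 1 by ring.
  have -> : (n%:R ^+ 2)^-1 `^ (t - 1) = (n%:R `^ (2 * t - 2))^-1 :> R.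
    have -> : n%:R = expR (ln n%:R) :> R by rewrite lnK.
    rewrite -expRM_natl -expRN !powR_expR -expRN; congr expR; ring.
  by ring.
have GE0 : 0 <= G `^ (2 - t) * E `^ (t - 1) by rewrite mulr_ge0 ?powR_ge0.
have B3 : (M + n%:R^-1) `^ (2 - t) / n%:R `^ (2 * t - 2) <= 4 * rate n cI t p `^ t.
  apply: (@le_trans _ _ (2 * (M `^ (2 - t) + n%:R^-1 `^ (2 - t)) / n%:R `^ (2 * t - 2))).
    rewrite ler_wpM2r ?invr_ge0 ?powR_ge0 //; exact: powR_add_le.
  rewrite -mulrA [4 * _](_ : _ = 2 * (rate n cI t p `^ t + rate n cI t p `^ t)).
    by rewrite ler_wpM2l // mulrDl lerD.
  by ring.
apply: (@le_lt_trans _ _ (8 * (G `^ (2 - t) * E `^ (t - 1)) * rate n cI t p `^ t)).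
  rewrite [leRHS](_ : _ = 2 * (G `^ (2 - t) * E `^ (t - 1) * (4 * rate n cI t p `^ t))).
    by rewrite ler_wpM2l // ler_wpM2l.
  by ring.
by rewrite ltr_pM2r // /C ltrDl.
Qed.

End UpperBound.

(** * From tests and norms to the minimax risk *)

Section Risk.
Context {R : realType} {N n : nat}.
Implicit Types (p q : vec R N) (t rho eta : R) (psi : test N n).
Local Open Scope classical_set_scope.

Lemma risk_le p t rho psi (a b : R) : 0 <= b -> Pq p psi <= a ->
  (forall q, in_cube q -> rho <= lpnorm t (fun j => p j - q j) ->
     Pq q (fun x => ~~ psi x) <= b) ->
  risk p t rho psi <= a + b.
Proof.
move=> b0 ha hb; rewrite lerD //.
(* Without admissible alternatives [sup set0 = 0], which is where [0 <= b] enters. *)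
set A := (X in sup X); have [->|/set0P A0] := eqVneq A set0; first by rewrite sup0.
by apply: ge_sup => // _ [q [hq hr] <-]; apply: hb.
Qed.

Lemma le_risk p t rho psi q : in_cube q -> rho <= lpnorm t (fun j => p j - q j) ->
  Pq p psi + Pq q (fun x => ~~ psi x) <= risk p t rho psi.
Proof.
move=> hq hr; rewrite lerD2l; apply: ub_le_sup; last by exists q.
by exists 1 => _ [q' [hq' _] <-]; apply: Pq_le1.
Qed.

Lemma Pq_le_risk p t rho psi : Pq p psi <= risk p t rho psi.
Proof.
rewrite lerDl; set A := (X in sup X).
have [->|/set0P[y [q [hq hr] _]]] := eqVneq A set0; first by rewrite sup0.
apply: (@le_trans _ _ (Pq q (fun x => ~~ psi x))); first exact: Pq_ge0.
by have := le_risk p t rho psi q hq hr; rewrite lerD2l.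
Qed.

Lemma risk_ge0 p t rho psi : in_cube p -> 0 <= risk p t rho psi.
Proof. by move=> hp; apply: le_trans (Pq_le_risk p t rho psi); apply: Pq_ge0. Qed.

Lemma minimax_risk_le p t rho psi : in_cube p ->
  minimax_risk n p t rho <= risk p t rho psi.
Proof.
move=> hp; apply: ge_inf; last by exists psi.
by exists 0 => _ [phi _ <-]; apply: risk_ge0.
Qed.

Lemma sep_radius_le p t rho eta : 0 < rho -> minimax_risk n p t rho <= eta ->
  sep_radius n p t eta <= rho.
Proof.
move=> r0 hr; apply: ge_inf; last by [].
by exists 0 => x [/ltW].
Qed.

Lemma le_lpnorm t rho (x : vec R N) : 1 <= t -> 0 <= rho -> 
  rho `^ t <= \sum_j `|x j| `^ t -> rho <= lpnorm t x.
Proof.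
move=> t1 r0 h.
have t0 : 0 < t by lra.
have -> : rho = (rho `^ t) `^ t^-1.
  by rewrite -powRrM divff ?gt_eqF // powRr1.
by apply: ler_powR2; rewrite ?powR_ge0 // invr_ge0 ltW.
Qed.

Lemma lpnorm_ge t rho (x : vec R N) : 1 <= t -> 0 <= rho -> rho <= lpnorm t x ->
  rho `^ t <= \sum_j `|x j| `^ t.
Proof.
move=> t1 r0 h.
have t0 : 0 < t by lra.
have s0 : 0 <= \sum_j `|x j| `^ t by apply: sumr_ge0 => j _; apply: powR_ge0.
rewrite -[leRHS](powRr1 s0) -(@mulVf _ t) ?gt_eqF // powRrM.
by apply: ler_powR2 => //; apply: ltW.
Qed.

End Risk.

Section UpperBoundRadius.
Context {R : realType}.

(** Reject when either test rejects: the false alarms add up to [eta / 2], and a separated [q] must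
    be separated on the bulk or on the tail. *)
Lemma minimax_risk_rate (eta t cI : R) : 0 < eta < 1 -> 1 <= t <= 2 -> 0 < cI ->
  exists2 C : R, 0 < C & forall (N n : nat) (p : vec R N),
    (2 <= n)%N -> ~~ odd n -> standing p ->
    0 < rate n cI t p /\ minimax_risk n p t (C * rate n cI t p) <= eta.
Proof.
move=> heta ht cI0; have /andP[eta0 eta1] := heta; have /andP[t1 t2] := ht.
have [C1 C10 h1] := bulk_test eta t cI heta ht cI0.
have [C2 C20 h2] := tail_test eta t cI heta ht cI0.
(* The leading 1 ensures [C <= C^t]; [C1 + C2] lets the pigeonhole between bulk and tail go
   through. *)
pose C := 1 + C1 + C2.
exists C => [|N n p n2 nev sp]; first by rewrite /C; lra.
have [p01 _] := sp.
have rpos : 0 < rate n cI t p.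
  rewrite rateE // ltr_wpDl ?addr_ge0 ?sqrtr_ge0 ?divr_ge0 ?powR_ge0 //.
  by rewrite ?divr_gt0 ?ltr0n // (ltn_trans _ n2).
split=> //.
have [psi1 [a1 b1]] := h1 N n p n2 nev sp.
have [psi2 [a2 b2]] := h2 N n p n2 nev sp.
apply: le_trans (minimax_risk_le p t _ (fun x => psi1 x || psi2 x) p01) _.
have -> : eta = eta / 2 + eta / 2 by field.
apply: risk_le; first by lra.
  by apply: le_trans (Pq_or p psi1 psi2 p01) _; lra.
move=> q hq hr.
have hr' : C * rate n cI t p `^ t <= \sum_j `|p j - q j| `^ t.
  have C0 : 0 <= C by rewrite /C; lra.
  have := lpnorm_ge t _ (fun j => p j - q j) t1 _ hr.
  rewrite mulr_ge0 ?(ltW rpos) // => /(_ isT); apply: le_trans.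
  rewrite powRM ?(ltW rpos) // ler_wpM2r ?powR_ge0 //.
  by apply: le1r_powR => //; rewrite /C; lra.
set I := Iidx n cI p in b1 b2.
rewrite (bigID (fun j : 'I_N => (j < I)%N)) /= in hr'.
have rt : 0 < rate n cI t p `^ t by rewrite powR_gt0.
have [hB|hB] := leP (C1 * rate n cI t p `^ t)
   (\sum_(j < N | (j < I)%N) `|p j - q j| `^ t).
  apply: le_trans (b1 q hq hB); apply: Pq_le => // x.
  by rewrite negb_or => /andP[].
apply: le_trans (b2 q hq _); first by apply: Pq_le => // x; rewrite negb_or => /andP[].
under eq_bigl do rewrite leqNgt.
move: hr' hB; rewrite /C !mulrDl; lra.
Qed.

End UpperBoundRadius.

(** * Lower bounds *)

(** Weierstrass's product inequality; the induction also carries that the product stays in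
    [[0, 1]]. *)
Lemma prod_one_sub_ge {R : realType} (T : finType) (P : pred T) (a : T -> R) :
  (forall i, P i -> 0 <= a i <= 1) ->
  1 - \sum_(i | P i) a i <= \prod_(i | P i) (1 - a i).
Proof.
move=> ha.
suff [] : 1 - \sum_(i | P i) a i <= \prod_(i | P i) (1 - a i) /\
  0 <= \prod_(i | P i) (1 - a i) <= 1 by [].
elim/big_rec2: _ => [|i y z Pi [h /andP[y0 y1]]].
  by rewrite subr0 !lexx ler01.
have /andP[a0 a1] := ha i Pi; split; first by nra.
by apply/andP; split; nra.
Qed.

Lemma expr_one_sub_ge {R : realType} (n : nat) (a : R) : 0 <= a <= 1 ->
  1 - n%:R * a <= (1 - a) ^+ n.
Proof.
move=> ha; have := @prod_one_sub_ge R 'I_n xpredT (fun=> a) (fun _ _ => ha).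
by rewrite sumr_const prodr_const card_ord mulr_natl.
Qed.

(** * Priors that are hard to distinguish from [p] *)

Section LowerBoundTools.
Context {R : realType} {N n : nat}.
Implicit Types (p q g : vec R N) (t rho eta : R) (psi : test N n).

(** The existence of an admissible radius is required because the infimum of an empty set is 0 by
    convention; later it comes from the upper bound. *)
Lemma le_sep_radius p t eta rho0 delta : in_cube p ->
  (exists rho, 0 < rho /\ minimax_risk n p t rho <= eta) -> eta < delta ->
  (forall rho psi, 0 < rho <= rho0 -> delta <= risk p t rho psi) ->
  rho0 <= sep_radius n p t eta.
Proof.
move=> hp [rho1 h1] hd h; apply: lb_le_inf; first by exists rho1.
move=> rho [r0 hr]; rewrite leNgt; apply/negP => rr.
have : delta <= minimax_risk n p t rho.
  apply: lb_le_inf; first by exists (@risk R N n p t rho xpredT); exists xpredT.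
  by move=> _ [psi _ <-]; apply: h; rewrite r0 ltW.
by move=> /le_trans /(_ hr); rewrite leNgt hd.
Qed.

(** The worst case dominates the average over a prior, up to the mass of draws [b] that fall too
    close to [p]. A prior is encoded as a Bernoulli sample of size 1, so the lemmas on [expect]
    apply to it. *)
Lemma risk_prior p t rho psi (pi : vec R N) (Q : sample N 1 -> vec R N)
    (bad : pred (sample N 1)) :
  in_cube p -> in_cube pi -> (forall b, in_cube (Q b)) ->
  (forall b, ~~ bad b -> rho <= lpnorm t (fun j => p j - Q b j)) ->
  Pq p psi + expect pi (fun b => Pq (Q b) (fun x => ~~ psi x)) - Pq pi bad
    <= risk p t rho psi.
Proof.
move=> hp hpi hQ hgood.
set s := risk p t rho psi - Pq p psi.
have s0 : 0 <= s by rewrite subr_ge0 Pq_le_risk.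
suff h : expect pi (fun b => Pq (Q b) (fun x => ~~ psi x)) <= s + Pq pi bad.
  by move: h; rewrite /s; lra.
rewrite PqE -[s](@expect_cst R N 1 pi) -expectD; apply: expect_le => // b /=.
case: (boolP (bad b)) => [_|/hgood hb].
  by rewrite (le_trans (Pq_le1 _ _ (hQ b))) // lerDr.
have := le_risk p t rho psi (Q b) (hQ b) hb.
rewrite /s addr0; lra.
Qed.

(** Raising one coordinate by [d] multiplies each observation's likelihood by at least [1 - 2 d],
    because [1 - p i >= 1 / 2]. The [n] observations together lose at most a factor [1 - 2 n d]. *)
Lemma shift_risk p t (d rho : R) psi (i : 'I_N) : 1 <= t -> standing p ->
  0 <= d <= 1 / 2 -> rho <= d -> 1 - 2 * n%:R * d <= risk p t rho psi.
Proof.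
move=> t1 [p01 [_ phalf]] /andP[d0 d1] rd.
pose q (j : 'I_N) := if j == i then p j + d else p j.
have hq : in_cube q.
  move=> j; have /andP[a b] := p01 j; have := phalf j.
  by rewrite /q; case: ifP => _ h; apply/andP; split; lra.
have hr : rho <= lpnorm t (fun j => p j - q j).
  apply: le_trans rd _; apply: le_lpnorm => //; rewrite (bigD1 i) //= /q eqxx.
  have -> : p i - (p i + d) = - d by ring.
  by rewrite normrN ger0_norm // lerDl sumr_ge0 // => j _; apply: powR_ge0.
apply: le_trans (le_risk p t rho psi q hq hr).
have hpt (x : sample N n) : (1 - 2 * n%:R * d) * Pq_pt p x <= Pq_pt q x.
  apply: (@le_trans _ _ ((1 - 2 * d) ^+ n * Pq_pt p x)).
    rewrite ler_wpM2r ?Pq_pt_ge0 //.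
    have -> : 2 * n%:R * d = n%:R * (2 * d) by ring.
    by apply: expr_one_sub_ge; lra.
  rewrite [leLHS](_ : _ = \prod_(l < n) ((1 - 2 * d) *
    \prod_(j < N) (if x l j then p j else 1 - p j))); last first.
    by rewrite big_split /= prodr_const card_ord.
  apply: ler_prod => l _.
  have f0 (r : vec R N) j : in_cube r -> 0 <= (if x l j then r j else 1 - r j).
    by move=> hc; have /andP[a b] := hc j; case: ifP; rewrite ?subr_ge0.
  apply/andP; split.
    apply: mulr_ge0; first by lra.
    by apply: prodr_ge0 => j _; apply: f0.
  rewrite (bigD1 i) //= [leRHS](bigD1 i) //= mulrA.
  rewrite [leRHS](_ : _ = (if x l i then q i else 1 - q i) *
    \prod_(j < N | j != i) (if x l j then p j else 1 - p j)); last first.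
    congr (_ * _); apply: eq_bigr => j /negbTE ji; by rewrite /q ji.
  rewrite ler_wpM2r //; first by apply: prodr_ge0 => j _; apply: f0.
  have /andP[a b] := p01 i; have := phalf i; rewrite /q eqxx.
  by case: (x l i) => h; nra.
have e : Pq p psi + Pq p (fun x => ~~ psi x) = 1 by rewrite PqC addrC subrK.
have hP (B : pred (sample N n)) : (1 - 2 * n%:R * d) * Pq p B <= Pq q B.
  by rewrite /Pq mulr_sumr; apply: ler_sum => x _.
have := hP (fun x => ~~ psi x); rewrite PqC.
have hpsi0 : 0 <= Pq p psi by apply: Pq_ge0.
have nd : 0 <= n%:R * d by rewrite mulr_ge0.
nra.
Qed.

Lemma expect_prior_prod (pi : vec R N) (F : 'I_N -> bool -> R) :
  expect pi (fun b : sample N 1 => \prod_(j < N) F j (b ord0 j))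
  = \prod_(j < N) (pi j * F j true + (1 - pi j) * F j false).
Proof.
rewrite /expect.
transitivity (\sum_(b : sample N 1) \prod_(l < 1) \prod_(j < N)
   ((if b l j then pi j else 1 - pi j) * F j (b l j))).
  by apply: eq_bigr => b _; rewrite /Pq_pt !big_ord1 -big_split.
rewrite (sum_sample_prod (fun _ j c => (if c then pi j else 1 - pi j) * F j c)).
by rewrite big_ord1.
Qed.

(** * Columns of the sample and the sparse prior *)

Definition column (x : sample N n) (j : 'I_N) : {ffun 'I_n -> bool} :=
  [ffun l => x l j].

Definition col_prob (a : R) (c : {ffun 'I_n -> bool}) : R :=
  \prod_(l < n) (if c l then a else 1 - a).

Lemma Pq_pt_col q x : Pq_pt q x = \prod_(j < N) col_prob (q j) (column x j).
Proof.
rewrite /Pq_pt exchange_big; apply: eq_bigr => j _.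
by apply: eq_bigr => l _; rewrite ffunE.
Qed.

Lemma sum_col_prod (F : 'I_N -> {ffun 'I_n -> bool} -> R) :
  \sum_(x : sample N n) \prod_(j < N) F j (column x j)
  = \prod_(j < N) \sum_c F j c.
Proof.
rewrite bigA_distr_bigA.
pose tr (y : {ffun 'I_N -> {ffun 'I_n -> bool}}) : sample N n :=
  [ffun l => [ffun j => y j l]].
rewrite (reindex tr) /=.
  apply: eq_bigr => y _; apply: eq_bigr => j _; congr (F j _).
  by apply/ffunP => l; rewrite !ffunE.
exists (fun x => [ffun j => column x j]) => x _;
  by apply/ffunP => i; apply/ffunP => l; rewrite !ffunE.
Qed.

Lemma sum_col_prob a : \sum_c col_prob a c = 1.
Proof.
rewrite /col_prob -(bigA_distr_bigA (fun (_ : 'I_n) b => if b then a else 1 - a)).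
by rewrite big1 // => l _; rewrite big_bool /= addrC subrK.
Qed.

Lemma col_prob_ge0 a c : 0 <= a <= 1 -> 0 <= col_prob a c.
Proof.
by move=> /andP[a0 a1]; apply: prodr_ge0 => l _; case: ifP; rewrite ?subr_ge0.
Qed.

Definition col0 : {ffun 'I_n -> bool} := [ffun=> false].
Definition col1 (l : 'I_n) : {ffun 'I_n -> bool} := [ffun l' => l' == l].

Lemma col_prob0 a : col_prob a col0 = (1 - a) ^+ n.
Proof.
rewrite /col_prob (eq_bigr (fun=> 1 - a)); last by move=> l _; rewrite ffunE.
by rewrite prodr_const card_ord.
Qed.

Lemma col_prob1 a l : col_prob a (col1 l) = a * (1 - a) ^+ n.-1.
Proof.
rewrite /col_prob (bigD1 l) //= ffunE eqxx; congr (_ * _).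
rewrite (eq_bigr (fun=> 1 - a)); last first.
  by move=> l' /negbTE ll; rewrite ffunE ll.
by rewrite prodr_const cardC1 card_ord.
Qed.

(** A minorising measure carried by the columns with at most one success. *)
Definition spike (a0 a1 : R) (c : {ffun 'I_n -> bool}) : R :=
  (c == col0)%:R * a0 + \sum_(l < n) (c == col1 l)%:R * a1.

Lemma sum_spike a0 a1 : \sum_c spike a0 a1 c = a0 + n%:R * a1.
Proof.
have s1 c0 (a : R) : \sum_(c : {ffun 'I_n -> bool}) (c == c0)%:R * a = a.
  rewrite (bigD1 c0) //= eqxx mul1r big1 ?addr0 // => c /negbTE ->.
  by rewrite mul0r.
rewrite big_split /= s1 exchange_big /=; congr (_ + _).
by rewrite (eq_bigr (fun=> a1)) ?sumr_const ?card_ord ?mulr_natl.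
Qed.

Lemma spike_le a0 a1 (F : {ffun 'I_n -> bool} -> R) c : (forall c, 0 <= F c) ->
  a0 <= F col0 -> (forall l, a1 <= F (col1 l)) -> spike a0 a1 c <= F c.
Proof.
move=> F0 h0 h1; rewrite /spike.
have [->|c0] := eqVneq c col0.
  rewrite mul1r big1 ?addr0 // => l _; case: eqP => [/ffunP /(_ l)|_].
    by rewrite !ffunE eqxx.
  by rewrite mul0r.
rewrite mul0r add0r.
have [/existsP[l /eqP ->]|/existsPn hn] := boolP [exists l, c == col1 l].
  rewrite (bigD1 l) //= eqxx mul1r big1 ?addr0 // => l' ll'.
  case: eqP => [/ffunP /(_ l)|_]; last by rewrite mul0r.
  by rewrite !ffunE eqxx => /esym /eqP e; move: ll'; rewrite e eqxx.
by rewrite big1 // => l _; rewrite (negbTE (hn l)) mul0r.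
Qed.

Definition sparse_weight p (J : pred 'I_N) (h : R) : vec R N :=
  fun j => if J j then p j / h else 0.

Definition sparse_alt p (J : pred 'I_N) (h : R) (b : sample N 1) : vec R N :=
  fun j => if J j then (if b ord0 j then h else 0) else p j.

(* A prior on the support [J] that draws [q_j = h] with probability [p_j / h]
   and [q_j = 0] otherwise has the same mean as [p], so it can only be told
   apart from [p] by a coordinate observed at least twice. *)
Lemma sparse_prior_risk p psi (J : pred 'I_N) (h : R) :
  (0 < n)%N -> in_cube p -> 0 < h <= 1 -> n%:R * h <= 1 -> (forall j, J j -> p j <= h) ->
  1 - n%:R ^+ 2 * h * (\sum_(j | J j) p j) <= Pq p psi +
    expect (sparse_weight p J h) (fun b => Pq (sparse_alt p J h b) (fun x => ~~ psi x)).
Proof.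
move=> n0 hp /andP[h0 h1] nh hJ; set pi := sparse_weight p J h.
(* [m j] minorises the law of column [j] both under [p] and under the prior. *)
pose m (j : 'I_N) : {ffun 'I_n -> bool} -> R :=
  if J j then spike (1 - n%:R * p j) (p j * (1 - n%:R * h)) else col_prob (p j).
have pw (a : R) : 0 <= a <= h -> 1 - n%:R * h <= (1 - a) ^+ n.-1.
  move=> /andP[a0 ah]; have a1 : a <= 1 by lra.
  apply: (@le_trans _ _ ((1 - a) ^+ n)).
    apply: (@le_trans _ _ (1 - n%:R * a)); last by apply: expr_one_sub_ge; lra.
    by rewrite lerD2l lerN2 ler_wpM2l.
  by rewrite -[in leLHS](prednK n0) exprS ler_piMl ?exprn_ge0 ?subr_ge0 // gerBl.
have m0 j c : 0 <= m j c.
  have /andP[p0 p1] := hp j.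
  rewrite /m; case: ifP => Jj; last by apply: col_prob_ge0; rewrite p0.
  have nph : n%:R * p j <= n%:R * h by rewrite ler_wpM2l // hJ.
  rewrite /spike addr_ge0 ?mulr_ge0 ?subr_ge0 //; first exact: le_trans nph _.
  by apply: sumr_ge0 => l _; rewrite !mulr_ge0 ?subr_ge0.
have mP j c : m j c <= col_prob (p j) c.
  have /andP[p0 p1] := hp j; rewrite /m; case: ifP => Jj //.
  apply: spike_le => [c'||l]; first by apply: col_prob_ge0; rewrite p0.
    by rewrite col_prob0 expr_one_sub_ge // p0.
  by rewrite col_prob1 ler_wpM2l // pw // p0 hJ.
pose F x j (b : bool) := col_prob (if J j then (if b then h else 0) else p j) (column x j).
have mQ x j : m j (column x j) <= pi j * F x j true + (1 - pi j) * F x j false.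
  have /andP[p0 p1] := hp j; rewrite /m /pi /sparse_weight /F; case: ifP => Jj; last first.
    by rewrite mul0r add0r subr0 mul1r.
  have p_h : 0 <= p j / h by rewrite divr_ge0 // ltW.
  have p_h1 : 0 <= 1 - p j / h by rewrite subr_ge0 ler_pdivrMr // mul1r hJ.
  apply: (spike_le _ _ (fun c => p j / h * col_prob h c + (1 - p j / h) * col_prob 0 c)).
  - by move=> c; rewrite addr_ge0 // mulr_ge0 // col_prob_ge0 ?ler01 ?lexx ?(ltW h0).
  (* On the empty column, [(1 - h)^n >= 1 - n h] turns the mixture into at least [1 - n p j]. *)
  - rewrite !col_prob0 subr0 expr1n mulr1.
    have e : p j / h * (1 - n%:R * h) = p j / h - n%:R * p j.
      by field; rewrite gt_eqF.
    have h01 : 0 <= h <= 1 by rewrite h1 ltW.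
    have := ler_wpM2l p_h (expr_one_sub_ge n h h01); rewrite e; lra.
  - move=> l; rewrite !col_prob1 mul0r mulr0 addr0.
    have -> : p j / h * (h * (1 - h) ^+ n.-1) = p j * (1 - h) ^+ n.-1.
      by field; rewrite gt_eqF.
    by rewrite ler_wpM2l // pw // lexx ltW.
have EQ : expect pi (fun b => Pq (sparse_alt p J h b) (fun x => ~~ psi x)) =
    \sum_(x | ~~ psi x) \prod_(j < N) (pi j * F x j true + (1 - pi j) * F x j false).
  rewrite /Pq expect_sum; apply: eq_bigr => x _.
  rewrite -expect_prior_prod; apply: eq_expect => b.
  by rewrite Pq_pt_col.
rewrite EQ.
(* Both error terms dominate the product of the [m j] on their part of the sample space, so their
   sum is at least its total mass. Each [J] column has mass [1 - n p j + n p j (1 - n h) = 1 - n^2 h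
   p j]. *)
apply: (@le_trans _ _ (\sum_(x : sample N n) \prod_(j < N) m j (column x j))); last first.
  rewrite (bigID psi) /=; apply: lerD; apply: ler_sum => x _.
    by rewrite Pq_pt_col; apply: ler_prod => j _; rewrite m0 mP.
  by apply: ler_prod => j _; rewrite m0 mQ.
rewrite sum_col_prod.
rewrite [leRHS](eq_bigr (fun j => 1 - (if J j then n%:R ^+ 2 * h * p j else 0))); last first.
  move=> j _; rewrite /m; case: ifP => _; last by rewrite subr0; exact: sum_col_prob.
  by apply: etrans (sum_spike _ _) _; ring.
apply: le_trans (prod_one_sub_ge _ _ _ _); last first.
  move=> j _; have /andP[p0 p1] := hp j; case: ifP => Jj; last by rewrite lexx ler01.
  rewrite !mulr_ge0 ?sqr_ge0 ?(ltW h0) //=.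
  have -> : n%:R ^+ 2 * h * p j = (n%:R * h) * (n%:R * p j) by ring.
  apply: mulr_ile1 => //; rewrite ?mulr_ge0 ?(ltW h0) //.
  by apply: le_trans nh; rewrite ler_wpM2l // hJ.
by rewrite -big_mkcond /= mulr_sumr.
Qed.

(** * Random signs and the chi-square bound *)

Lemma expect_quadratic q (f : sample N n -> R) (c0 c1 c2 : R) :
  expect q (fun x => c0 + (c1 * f x + c2 * f x ^+ 2))
  = c0 + (c1 * expect q f + c2 * expect q (fun x => f x ^+ 2)).
Proof.
rewrite (expectD q (fun=> c0) (fun x => c1 * f x + c2 * f x ^+ 2)) expect_cst.
by rewrite (expectD q (fun x => c1 * f x) (fun x => c2 * f x ^+ 2)) !expectZ.
Qed.

Definition sgnb (b : bool) : R := if b then 1 else -1.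

(** Averaging over the sign of [u] removes the linear term. The induction runs jointly on the even
    part [B] and the odd part [D] of [(1 + u)^k], each step adding [u] times the other part. *)
Lemma avg_expr_le (m : nat) (u : R) : 0 <= u -> m%:R * u <= 1 ->
  2^-1 * ((1 + u) ^+ m + (1 - u) ^+ m) <= 1 + (m%:R * u) ^+ 2.
Proof.
move=> u0.
pose B k := 2^-1 * ((1 + u) ^+ k + (1 - u) ^+ k).
pose D k := 2^-1 * ((1 + u) ^+ k - (1 - u) ^+ k).
suff h : forall k, k%:R * u <= 1 -> B k <= 1 + (k%:R * u) ^+ 2 /\ D k <= 2 * (k%:R * u).
  by move=> mu; have [] := h m mu.
elim=> [|k IH] hk; first by rewrite /B /D !expr0 !mul0r expr0n /=; split; lra.
have ku : k%:R * u <= 1 by apply: le_trans hk; rewrite ler_wpM2r // ler_nat.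
have ku0 : 0 <= k%:R * u by rewrite mulr_ge0.
have [hB hD] := IH ku.
have BE : B k.+1 = B k + u * D k by rewrite /B /D !exprS; ring.
have DE : D k.+1 = D k + u * B k by rewrite /B /D !exprS; ring.
have kE : k.+1%:R * u = k%:R * u + u by rewrite -natr1 mulrDl mul1r.
rewrite BE DE kE; set y := k%:R * u in hB hD ku ku0 *; split.
  have := ler_wpM2l u0 hD; nra.
have y2 : y ^+ 2 <= 1 by rewrite expr_le1.
have := ler_wpM2l u0 hB; have := ler_wpM2l u0 y2; lra.
Qed.

(** Since [(1 + a)(1 - a) <= 1], the product is at most [1 / (1 - U)], hence at most [1 + 2 U] for
    [U <= 1 / 2]. *)
Lemma prod_one_add_le (a : 'I_N -> R) (U : R) : (forall j, 0 <= a j) ->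
  \sum_j a j <= U -> U <= 1 / 2 -> \prod_j (1 + a j) <= 1 + 2 * U.
Proof.
move=> a0 hU U1.
have aj j : a j <= 1.
  have : a j <= \sum_i a i by rewrite (bigD1 j) //= lerDl sumr_ge0.
  lra.
have h1 : 1 - U <= \prod_j (1 - a j).
  apply: le_trans (prod_one_sub_ge _ xpredT a _); first by rewrite lerD2l lerN2.
  by move=> j _; rewrite a0 aj.
have h2 : \prod_j (1 + a j) * \prod_j (1 - a j) <= 1.
  rewrite -big_split /=; apply: prodr_ile1 => j _.
  by have := a0 j; have := aj j; move=> *; apply/andP; split; nra.
have h3 : 0 <= \prod_j (1 + a j).
  by apply: prodr_ge0 => j _; have := a0 j; lra.
have U0 : 0 <= U by apply: le_trans hU; apply: sumr_ge0.
set X := \prod_j (1 + a j) in h2 h3 *.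
have h4 : X * (1 - U) <= 1 by apply: le_trans h2; rewrite ler_wpM2l.
have : (1 + 2 * U) * (1 - U) >= 1 by nra.
move=> h5; rewrite -(@ler_pM2r _ (1 - U)); first exact: le_trans h4 _.
lra.
Qed.

Definition sign_alt p g (b : sample N 1) : vec R N :=
  fun j => p j + sgnb (b ord0 j) * g j.

Lemma in_cube_sign_alt p g b : standing p -> (forall j, 0 <= g j <= p j) ->
  in_cube (sign_alt p g b).
Proof.
move=> [_ [_ ph]] hg j; have /andP[g0 gp] := hg j; have := ph j.
by rewrite /sign_alt /sgnb; case: (b ord0 j) => hj; apply/andP; split; lra.
Qed.

(** Second-moment method: the averaged likelihood ratio [Lb] has mean 1 and second moment at most
    [1 + a^2] under [p], so the sum of the errors is at least [1 - a]. *)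
Lemma sign_prior_risk p psi g (a : R) :
  standing p -> (forall j, 0 <= g j <= p j) -> 0 < a <= 1 ->
  \sum_j (n%:R * (g j ^+ 2 / (p j * (1 - p j)))) ^+ 2 <= a ^+ 2 / 2 ->
  1 - a <= Pq p psi +
    expect (fun=> 1 / 2) (fun b => Pq (sign_alt p g b) (fun x => ~~ psi x)).
Proof.
move=> [p01 [_ phalf]] hg /andP[a0 a1] hU; set Q := sign_alt p g.
pose u j := g j ^+ 2 / (p j * (1 - p j)).
pose f (b : sample N 1) (l : 'I_n) j (c : bool) :=
  1 + sgnb (b ord0 j) * (g j * (c%:R - p j) / (p j * (1 - p j))).
pose L b (x : sample N n) := \prod_(l < n) \prod_(j < N) f b l j (x l j).
have hQ b x : Pq_pt (Q b) x = Pq_pt p x * L b x.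
  rewrite /Pq_pt /L -big_split; apply: eq_bigr => l _ /=.
  rewrite -big_split; apply: eq_bigr => j _ /=; rewrite /Q /sign_alt /f.
  have /andP[g0 gp] := hg j; have ph := phalf j.
  (* When [p j = 0] also [g j = 0], and the division by zero in [f] returns 0, as needed. *)
  have [pj0|pj0] := eqVneq (p j) 0.
    have -> : g j = 0 by apply/eqP; rewrite eq_le g0 andbT -pj0.
    by rewrite pj0 !(mul0r, mulr0, addr0); case: ifP; rewrite mulr1.
  have p1 : 1 - p j != 0 by rewrite gt_eqF //; lra.
  by case: (x l j) => /=; field; rewrite pj0 p1.
have half01 : in_cube (fun _ : 'I_N => 1 / 2 : R) by move=> j; lra.
pose Lb x := expect (fun=> 1 / 2) (fun b => L b x).
have EQ : expect (fun=> 1 / 2) (fun b => Pq (Q b) (fun x => ~~ psi x)) =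
    \sum_(x | ~~ psi x) Pq_pt p x * Lb x.
  rewrite /Pq expect_sum; apply: eq_bigr => x _.
  by rewrite /Lb -expectZ; apply: eq_expect => b; rewrite hQ.
have ELL b b' : expect p (fun x => L b x * L b' x) =
    \prod_j (1 + sgnb (b ord0 j) * sgnb (b' ord0 j) * u j) ^+ n.
  transitivity (\sum_(x : sample N n) \prod_(l < n) \prod_(j < N)
     ((if x l j then p j else 1 - p j) * (f b l j (x l j) * f b' l j (x l j)))).
    apply: eq_bigr => x _; rewrite /Pq_pt /L -!big_split; apply: eq_bigr => l _ /=.
    by rewrite -!big_split.
  rewrite (sum_sample_prod (fun l j c => (if c then p j else 1 - p j) *
    (f b l j c * f b' l j c))) exchange_big /=; apply: eq_bigr => j _.
  rewrite (eq_bigr (fun=> 1 + sgnb (b ord0 j) * sgnb (b' ord0 j) * u j)).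
    by rewrite prodr_const card_ord.
  move=> l _; rewrite /f /u /=.
  have /andP[g0 gp] := hg j; have ph := phalf j.
  have [pj0|pj0] := eqVneq (p j) 0.
    have -> : g j = 0 by apply/eqP; rewrite eq_le g0 andbT -pj0.
    by rewrite pj0 expr0n /=; ring.
  have p1 : 1 - p j != 0 by rewrite gt_eqF //; lra.
  by field; rewrite pj0 p1.
have EL b : expect p (L b) = 1.
  have hQ1 := @expect1 R N n (Q b); rewrite -[RHS]hQ1.
  by apply: eq_bigr => x _; rewrite mulr1 hQ.
have ELb : expect p Lb = 1.
  rewrite /Lb /expect; under eq_bigr do rewrite mulr_sumr.
  rewrite exchange_big /= -[RHS](@expect1 R N 1 (fun=> 1 / 2)); apply: eq_bigr => b _.
  rewrite -(EL b) mulr_sumr; apply: eq_bigr => x _; ring.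
have ELb2 : expect p (fun x => Lb x ^+ 2) <= 1 + a ^+ 2.
  have -> : expect p (fun x => Lb x ^+ 2) =
    expect (fun=> 1 / 2) (fun b : sample N 1 => expect (fun=> 1 / 2)
      (fun b' : sample N 1 => expect p (fun x => L b x * L b' x))).
    rewrite /expect; under [RHS]eq_bigr do under eq_bigr do rewrite mulr_sumr.
    under [RHS]eq_bigr do rewrite exchange_big mulr_sumr.
    rewrite exchange_big; apply: eq_bigr => x _ /=.
    rewrite expr2 {1}/Lb /expect mulrA mulr_sumr mulr_suml; apply: eq_bigr => b _ /=.
    rewrite /Lb /expect !mulr_sumr; apply: eq_bigr => b' _; ring.
  have u0 j : 0 <= u j.
    have /andP[q0 q1] := p01 j.
    by rewrite divr_ge0 ?sqr_ge0 // mulr_ge0 // subr_ge0.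
  (* By sign symmetry the average over [b'] alone no longer depends on [b]. *)
  rewrite (eq_expect _ _ (fun=> \prod_j (2^-1 * ((1 + u j) ^+ n + (1 - u j) ^+ n)))).
    rewrite expect_cst.
    have nu j : n%:R * u j <= 1.
      have nu0 : 0 <= n%:R * u j := mulr_ge0 (ler0n R n) (u0 j).
      rewrite -(@ler_pXn2r _ 2) ?nnegrE // expr1n.
      apply: (@le_trans _ _ (a ^+ 2 / 2)); last by nra.
      apply: le_trans hU; rewrite (bigD1 j) //= lerDl.
      by apply: sumr_ge0 => i _; rewrite sqr_ge0.
    apply: (@le_trans _ _ (\prod_j (1 + (n%:R * u j) ^+ 2))).
      apply: ler_prod => j _; rewrite avg_expr_le // andbT.
      have uj1 : u j <= 1.
        have /andP[g0 gp] := hg j; have ph := phalf j.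
        have [pj0|pj0] := eqVneq (p j) 0.
          by rewrite /u pj0 mul0r invr0 mulr0.
        have pp : 0 < p j by rewrite lt_neqAle eq_sym pj0; lra.
        by rewrite /u ler_pdivrMr ?mulr_gt0 //; nra.
      have h1u : 0 <= 1 - u j by rewrite subr_ge0.
      have h2u : 0 <= 1 + u j := addr_ge0 ler01 (u0 j).
      by rewrite mulr_ge0 // addr_ge0 // exprn_ge0.
    have -> : 1 + a ^+ 2 = 1 + 2 * (a ^+ 2 / 2) by field.
    by apply: prod_one_add_le => // [j|]; [rewrite sqr_ge0|nra].
  move=> b.
  pose F j c := (1 + sgnb (b ord0 j) * sgnb c * u j) ^+ n.
  transitivity (expect (fun=> 1 / 2) (fun b' : sample N 1 => \prod_j F j (b' ord0 j))).
    by apply: eq_expect => b'; rewrite ELL.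
  rewrite (expect_prior_prod _ F); apply: eq_bigr => j _ /=; rewrite /F.
  rewrite /sgnb; case: (b ord0 j).
    have -> : 1 * -1 * u j = - u j by ring.
    by rewrite !mul1r; field.
  have -> : - 1 * -1 * u j = u j by ring.
  by rewrite mulr1 mulN1r; field.
rewrite EQ /Pq.
(* AM-GM: [|Lb - 1| <= a / 2 + (Lb - 1)^2 / (2 a)] *)
pose low x := 1 - (a / 2 + (2 * a)^-1 * (Lb x ^+ 2 + (- 2 * Lb x + 1))).
apply: (@le_trans _ _ (expect p low)).
  have -> : expect p low = 1 + (- 1) * (a / 2 + (2 * a)^-1 *
      (expect p (fun x => Lb x ^+ 2) + (- 2 * 1 + 1))).
    pose e := (2 * a)^-1.
    rewrite (eq_expect p _ (fun x => 1 - a / 2 - e + (2 * e * Lb x + - e * Lb x ^+ 2))).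
      by rewrite expect_quadratic ELb /e; ring.
    by move=> x; rewrite /low /e; ring.
  set z := expect p _ in ELb2 *.
  have h : (2 * a)^-1 * (z + (-2 * 1 + 1)) <= (2 * a)^-1 * a ^+ 2.
    by rewrite ler_wpM2l ?invr_ge0 ?mulr_ge0 ?(ltW a0) //; lra.
  have e : (2 * a)^-1 * a ^+ 2 = a / 2 by field; rewrite gt_eqF.
  rewrite e in h; lra.
rewrite [leRHS](_ : _ = expect p (fun x => if psi x then 1 else Lb x)); last first.
  rewrite /expect [RHS](bigID psi) /=; congr (_ + _); apply: eq_bigr => x hx.
    by rewrite hx mulr1.
  by rewrite (negbTE hx).
apply: expect_le => // x; rewrite /low.
set y := Lb x.
have h1 : 0 <= (2 * a)^-1 * (a - (y - 1)) ^+ 2.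
  by rewrite mulr_ge0 ?sqr_ge0 // invr_ge0 mulr_ge0 // ltW.
have h2 : 0 <= (2 * a)^-1 * (a + (y - 1)) ^+ 2.
  by rewrite mulr_ge0 ?sqr_ge0 // invr_ge0 mulr_ge0 // ltW.
have e1 : (2 * a)^-1 * (a + (y - 1)) ^+ 2 =
  a / 2 + (2 * a)^-1 * (y ^+ 2 + (- 2 * y + 1)) + (y - 1).
  by field; rewrite gt_eqF.
have h3 : 0 <= (2 * a)^-1 * (y - 1) ^+ 2.
  by rewrite mulr_ge0 ?sqr_ge0 // invr_ge0 mulr_ge0 // ltW.
have e3 : (2 * a)^-1 * (y - 1) ^+ 2 = (2 * a)^-1 * (y ^+ 2 + (- 2 * y + 1)) by ring.
case: ifP => _; lra.
Qed.

End LowerBoundTools.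

Lemma count_stat1 {R : realType} {N : nat} (J : pred 'I_N) (b : sample N 1) :
  count_stat J b = \sum_(j | J j) (b ord0 j)%:R :> R.
Proof.
transitivity (\sum_(l < 1) \sum_(j | J j) (b l j)%:R : R).
  by rewrite pair_big.
by rewrite big_ord1.
Qed.

(** * One lower bound on the separation radius for each term of the rate *)

Section LowerBoundRadius.
Context {R : realType} {N n : nat}.
Variables (p : vec R N) (t eta : R).
Hypotheses (ht : 1 <= t <= 2) (heta : 0 < eta < 1) (sp : standing p).
Hypothesis n0 : (0 < n)%N.
Hypothesis attained : exists rho, 0 < rho /\ minimax_risk n p t rho <= eta.

Let t1 : 1 <= t. Proof. by have /andP[] := ht. Qed.
Let t0 : 0 < t. Proof. exact: lt_le_trans ltr01 t1. Qed.
Let p01 : in_cube p. Proof. by have [] := sp. Qed.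
Let p0 j : 0 <= p j. Proof. by have /andP[] := p01 j. Qed.
Let nn0 : 0 < n%:R :> R. Proof. by rewrite ltr0n. Qed.
Let n1 : 1 <= n%:R :> R. Proof. by rewrite ler1n. Qed.

Lemma sep_radius_ge_inv : (0 < N)%N -> (1 - eta) / 4 / n%:R <= sep_radius n p t eta.
Proof.
move=> N0; have /andP[e0 e1] := heta.
apply: (le_sep_radius p t eta _ ((1 + eta) / 2)) => //; first by lra.
move=> rho psi /andP[_ hr].
have dn : (1 - eta) / 4 / n%:R <= 1 / 2.
  by rewrite ler_pdivrMr //; have := n1; lra.
have d0 : 0 <= (1 - eta) / 4 / n%:R by rewrite divr_ge0 //; lra.
have hd : 0 <= (1 - eta) / 4 / n%:R <= 1 / 2 by rewrite d0.
apply: le_trans (shift_risk p t _ rho psi (Ordinal N0) t1 sp hd hr).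
rewrite le_eqVlt; apply/orP; left; apply/eqP; field.
by rewrite gt_eqF.
Qed.

(** The sparse prior on the small tail coordinates. The assumption [4 <= n M] makes the number of
    active coordinates concentrate; for smaller [M] the tail term is of order [1 / n]. *)
Lemma sep_radius_ge_tail (cI : R) : 0 < cI -> cI <= (1 - eta) / 16 ->
  let I := Iidx n cI p in
  4 <= n%:R * tail_sum I p ->
  (1 - eta) / 64 * tail_rate n t (tail_sum I p) <= sep_radius n p t eta.
Proof.
move=> cI0 cIe I; have /andP[e0 e1] := heta.
have [IN hI _] := Iidx_spec (n:=n) cI p cI0.
set M := tail_sum I p => nM.
pose e := (1 - eta) / 4.
have ep : 0 < e by rewrite /e; lra.
have e_1 : e <= 1 by rewrite /e; lra.
have M0 : 0 < M by rewrite -(@pmulr_rgt0 _ n%:R) //; lra.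
(* Chosen so that [n^2 h M = e], the indistinguishability loss of the prior. *)
pose h := e / (n%:R ^+ 2 * M).
have n2M : 0 < n%:R ^+ 2 * M by rewrite mulr_gt0 // exprn_gt0.
have h0 : 0 < h by rewrite divr_gt0.
have hE : n%:R ^+ 2 * h * M = e by rewrite /h; field; rewrite !gt_eqF.
have nh : n%:R * h <= 1.
  have -> : n%:R * h = e / (n%:R * M) by rewrite /h; field; rewrite !gt_eqF.
  by rewrite ler_pdivrMr ?mulr_gt0 //; lra.
have h1 : h <= 1 by apply: le_trans nh; rewrite ler_peMl // ltW.
(* An active coordinate then moves by at least [h / 2]. The discarded ones satisfy
   [p j <= (2 / h) p j ^ 2], so [cI <= e / 4] limits their sum to [M / 2]. *)
pose J (j : 'I_N) := (I <= j)%N && (p j <= h / 2).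
have hJ j : J j -> p j <= h by move=> /andP[_ pj]; lra.
have JM : M / 2 <= \sum_(j | J j) p j.
  have : M = \sum_(j | J j) p j + \sum_(j < N | (I <= j)%N && ~~ (p j <= h / 2)) p j.
    by rewrite /M /tail_sum (bigID (fun j => p j <= h / 2)).
  suff : \sum_(j < N | (I <= j)%N && ~~ (p j <= h / 2)) p j <= M / 2 by lra.
  apply: (@le_trans _ _ (2 / h * tail_sq p I)).
    rewrite /tail_sq mulr_sumr big_mkcond [leRHS]big_mkcond; apply: ler_sum => j _.
    case: (I <= j)%N => //=; case: (leP (p j) (h / 2)) => /= hj.
      by rewrite mulr_ge0 ?sqr_ge0 // divr_ge0 // ltW.
    rewrite mulrAC ler_pdivlMr //.
    have := p0 j; nra.
  apply: (@le_trans _ _ (2 / h * (cI / n%:R ^+ 2))).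
    by rewrite ler_wpM2l // divr_ge0 // ltW.
  have -> : 2 / h * (cI / n%:R ^+ 2) = 2 * cI / e * M.
    by rewrite /h; field; rewrite !gt_eqF.
  rewrite mulrC ler_wpM2l ?(ltW M0) // ler_pdivrMr //; move: cIe; rewrite /e; lra.
pose pi := sparse_weight p J h.
(* The expected number of active coordinates; [m >= 8 / e] makes the bad event have probability at
   most [4 / m <= e / 2]. *)
pose m := \sum_(j | J j) pi j.
have mE : m = (\sum_(j | J j) p j) / h.
  rewrite /m mulr_suml; apply: eq_bigr => j Jj.
  by rewrite /pi /sparse_weight Jj.
have mM : M / (2 * h) <= m.
  rewrite mE ler_pdivlMr //; apply: le_trans JM; rewrite le_eqVlt; apply/orP; left.
  by apply/eqP; field; rewrite gt_eqF.
have m8 : 8 / e <= m.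
  apply: le_trans mM.
  have -> : M / (2 * h) = (n%:R * M) ^+ 2 / 2 / e.
    by rewrite /h; field; rewrite !gt_eqF.
  by rewrite ler_pM2r ?invr_gt0 //; nra.
have m0 : 0 < m by apply: lt_le_trans m8; rewrite divr_gt0.
have pi01 : in_cube pi.
  move=> j; rewrite /pi /sparse_weight; case: ifP => Jj; last by rewrite lexx ler01.
  by rewrite divr_ge0 ?(ltW h0) //= ler_pdivrMr // mul1r hJ.
have Q01 b : in_cube (sparse_alt p J h b).
  move=> j; rewrite /sparse_alt; case: ifP => Jj; last exact: p01.
  by case: (b ord0 j); rewrite ?lexx ?ler01 ?h1 ?(ltW h0).
pose bad (b : sample N 1) := count_stat J b < m / 2.
apply: (le_sep_radius p t eta _ ((1 + eta) / 2)) => //; first by lra.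
move=> rho psi /andP[r0 hr].
have hgood b : ~~ bad b -> rho <= lpnorm t (fun j => p j - sparse_alt p J h b j).
  rewrite /bad -leNgt => hb; apply: le_trans hr _.
  apply: le_lpnorm => //.
    by rewrite mulr_ge0 ?divr_ge0 ?powR_ge0 //; lra.
  have T0 : 0 <= tail_rate n t M by rewrite divr_ge0 ?powR_ge0.
  have e64 : (1 - eta) / 64 = e / 16 by rewrite /e; field.
  rewrite e64 powRM //; last by rewrite divr_ge0 // ltW.
  rewrite tail_rate_powR //.
  apply: (@le_trans _ _ (count_stat J b * (h / 2) `^ t)); last first.
    rewrite count_stat1.
    rewrite mulr_suml big_mkcond; apply: ler_sum => j _.
    rewrite /sparse_alt; case: ifP => Jj; last by rewrite powR_ge0.
    case: (b ord0 j); last by rewrite mul0r powR_ge0.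
    rewrite mul1r; apply: ler_powR2; rewrite ?(ltW t0) //; first by rewrite ltW // divr_gt0.
    rewrite distrC; apply: le_trans (ler_norm _).
    by move: Jj => /andP[_]; lra.
  apply: (@le_trans _ _ (M / (4 * h) * (h / 2) `^ t)); last first.
    rewrite ler_wpM2r ?powR_ge0 //; apply: le_trans hb.
    have -> : M / (4 * h) = M / (2 * h) / 2 by field; rewrite gt_eqF.
    by rewrite ler_wpM2r.
  have -> : M / (4 * h) * (h / 2) `^ t =
      e `^ (t - 1) / (4 * 2 `^ t) * (M `^ (2 - t) / n%:R `^ (2 * t - 2)).
    have k1 : M * (h `^ t / h) = e `^ (t - 1) * (M `^ (2 - t) / n%:R `^ (2 * t - 2)).
      have lnE (z : R) : 0 < z -> {Z | z = expR Z} by exists (ln z); rewrite lnK.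
      have [X eE] := lnE _ ep; have [Y ME] := lnE _ M0; have [Z nE] := lnE _ nn0.
      have hX : h = expR (X - 2 * Z - Y).
        by rewrite /h eE nE ME -expRM_natl -expRD -expRN -expRD; congr expR; ring.
      rewrite hX eE nE ME !powR_expR -!expRN -!expRD; congr expR.
      by ring.
    have two0 : 2 `^ t != 0 :> R by rewrite gt_eqF // powR_gt0.
    have nt0 : n%:R `^ (2 * t - 2) != 0 :> R by rewrite gt_eqF // powR_gt0.
    transitivity (M * (h `^ t / h) / (4 * 2 `^ t)).
      rewrite powRM ?invr_ge0 ?(ltW h0) // -[2^-1]powR_inv1 // -powRrM mulN1r powRN.
      by field; rewrite two0 gt_eqF.
    by rewrite k1; field; rewrite two0 nt0.
  rewrite ler_wpM2r ?divr_ge0 ?powR_ge0 //.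
  rewrite powRM ?invr_ge0 ?(ltW ep) //.
  apply: ler_pM; rewrite ?powR_ge0 //.
    by apply: ger_powR; [rewrite ep|lra].
  rewrite -[16^-1]powR_inv1 // -powRrM mulN1r powRN lef_pV2 ?posrE ?mulr_gt0 ?powR_gt0 //.
  have -> : 16 = 8 * 2 :> R by ring.
  rewrite powRM // ler_wpM2r ?powR_ge0 //.
  by apply: (@le_trans _ _ 8); [rewrite ler_nat|apply: le1r_powR; rewrite ?ler1n].
have hs := risk_prior p t rho psi pi (sparse_alt p J h) bad p01 pi01 Q01 hgood.
apply: le_trans hs.
have h01 : 0 < h <= 1 by rewrite h0.
have hs := sparse_prior_risk p psi J h n0 p01 h01 nh hJ.
have hb : Pq pi bad <= e / 2.
  apply: le_trans (Pq_count_stat_lt J pi m pi01 _ m0) _.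
    by rewrite mul1r.
  have -> : e / 2 = 4 / (8 / e) by field; rewrite gt_eqF.
  by rewrite ler_pM2l // lef_pV2 ?posrE // divr_gt0.
have hM : n%:R ^+ 2 * h * \sum_(j | J j) p j <= e.
  have n2h : 0 <= n%:R ^+ 2 * h := mulr_ge0 (sqr_ge0 _) (ltW h0).
  rewrite -[leRHS]hE ler_wpM2l //.
  rewrite /M /tail_sum /J big_mkcond [leRHS]big_mkcond; apply: ler_sum => j _.
  by case: (I <= j)%N => //=; case: ifP.
have : e = (1 - eta) / 4 by [].
move: hs hb hM; rewrite -/pi; lra.
Qed.

(** [G] collects the bulk coordinates where the desired perturbation stays below [p j]. If they
    carry half of the bulk sum, the sign prior applies; otherwise the remaining coordinates are so
    small that the bulk rate is at most a multiple of the mesh. *)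
Lemma sep_radius_ge_bulk (cI c : R) : 0 < cI -> 0 < c -> c <= (1 - eta) / 8 ->
  (0 < Iidx n cI p)%N -> let I := Iidx n cI p in
  c / 2 * bulk_rate n t (bulk_sum I t p) <= sep_radius n p t eta \/
  bulk_rate n t (bulk_sum I t p) <= 4 * c * mesh n I t.
Proof.
move=> cI0 c0 ce I0 I; have /andP[e0 e1] := heta.
have [IN _ _] := Iidx_spec (n:=n) cI p cI0.
have [a [a0 ap _]] := Iidx_boundary cI p I0 cI0 sp.
rewrite -/I in IN ap.
have lnE (z : R) : 0 < z -> {Z | z = expR Z} by exists (ln z); rewrite lnK.
pose r := r_exp t.
have r0 : 0 < r := r_exp_gt0 t ht.
have rE : r * (4 - t) = 2 * t.
  by rewrite /r /r_exp divfK // gt_eqF //; have /andP[] := ht; lra.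
have r2 : r <= 2.
  by rewrite /r /r_exp ler_pdivrMr; have /andP[] := ht; lra.
pose S := bulk_sum I t p.
have i0 : 0 < I%:R :> R by rewrite ltr0n.
have S0 : 0 < S.
  have : I%:R * a `^ r <= S.
    rewrite -(sum_ord_lt_const I _ IN); apply: ler_sum => j jI.
    by apply: ler_powR2; rewrite ?(ltW a0) ?(ltW r0) // ap.
  by apply: lt_le_trans; rewrite mulr_gt0 // powR_gt0.
have pI (j : 'I_N) : (j < I)%N -> 0 < p j by move=> /ap; apply: lt_le_trans.
have [Y nE] := lnE _ nn0; have [Z SE] := lnE _ S0; have [X cE] := lnE _ c0.
(* [la = c n^(-1/2) S^(-1/4)], calibrated so that [n^2 la^4 S = c^4]. *)
pose la := expR (X - Y / 2 - Z / 4).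
have la0 : 0 < la := expR_gt0 _.
have la4 : n%:R ^+ 2 * la ^+ 4 * S = c ^+ 4.
  by rewrite nE SE cE /la -!expRM_natl -!expRD; congr expR; field.
(* The perturbation is [la p^v]: [u + v = 1] turns [g <= p] into [la <= p^u], [4 v - 2 = r]
   evaluates the chi-square sum, and [v t = r] the separation. *)
pose u := 2^-1 - r / 4; pose v := 2^-1 + r / 4.
have u0 : 0 <= u by rewrite /u; lra.
pose G (j : 'I_N) := (j < I)%N && (la <= p j `^ u).
have [SG|SG] := leP (S / 2) (\sum_(j | G j) p j `^ r); [left|right].
  pose g (j : 'I_N) := if G j then la * p j `^ v else 0.
  have hg j : 0 <= g j <= p j.
    rewrite /g; case: ifP => [/andP[jI hj]|_]; last by rewrite lexx p0.
    rewrite mulr_ge0 ?powR_ge0 ?(ltW la0) //=.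
    have pE : p j `^ u * p j `^ v = p j.
      rewrite -powRD; last by rewrite (gt_eqF (pI j jI)) implybT.
      have -> : u + v = 1 by rewrite /u /v; field.
      by rewrite powRr1.
    by rewrite -[leRHS]pE ler_wpM2r ?powR_ge0.
  pose e := (1 - eta) / 4.
  have ep : 0 < e by rewrite /e; lra.
  have e_1 : 0 < e <= 1 by rewrite /e; apply/andP; split; lra.
  have hU : \sum_j (n%:R * (g j ^+ 2 / (p j * (1 - p j)))) ^+ 2 <= e ^+ 2 / 2.
    apply: (@le_trans _ _ (4 * n%:R ^+ 2 * la ^+ 4 * S)); last first.
      have -> : 4 * n%:R ^+ 2 * la ^+ 4 * S = 4 * c ^+ 4 by rewrite -la4; ring.
      have ce2 : c <= e / 2 by rewrite /e; lra.
      have c2 : c ^+ 2 <= (e / 2) ^+ 2.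
        have e20 : 0 <= e / 2 := divr_ge0 (ltW ep) (ler0n R 2).
        by rewrite lerXn2r ?nnegrE ?(ltW c0).
      have c4 : c ^+ 4 <= ((e / 2) ^+ 2) ^+ 2.
        by rewrite [c ^+ 4](exprM c 2 2) lerXn2r ?nnegrE ?sqr_ge0.
      have e2 : e ^+ 2 <= 1 by have /andP[_ ?] := e_1; rewrite expr_le1 // ltW.
      have e4 : ((e / 2) ^+ 2) ^+ 2 = e ^+ 2 * e ^+ 2 / 16 by field.
      rewrite e4 in c4; have := sqr_ge0 e; nra.
    rewrite /S /bulk_sum mulr_sumr [leRHS]big_mkcond; apply: ler_sum => j _.
    rewrite /g /G; have [_ [_ ph]] := sp; have := ph j; case: (ltnP j I) => jI /= pj2.
      2: by rewrite expr0n mul0r mulr0 expr0n.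
    have pj := pI j jI.
    case: ifP => _; last first.
      by rewrite expr0n mul0r mulr0 expr0n !mulr_ge0 ?powR_ge0 ?exprn_ge0 ?(ltW la0).
    have p2 : p j / 2 <= p j * (1 - p j) by nra.
    have pp0 : 0 < p j * (1 - p j) by rewrite mulr_gt0 //; lra.
    have p3 : p j ^+ 2 / 4 <= (p j * (1 - p j)) ^+ 2.
      have -> : p j ^+ 2 / 4 = (p j / 2) ^+ 2 by field.
      by rewrite lerXn2r ?nnegrE ?(ltW pp0) ?divr_ge0 ?(ltW pj).
    rewrite exprMn expr_div_n mulrA ler_pdivrMr ?exprn_gt0 //.
    apply: (@le_trans _ _ (4 * n%:R ^+ 2 * la ^+ 4 * p j `^ r * (p j ^+ 2 / 4))); last first.
      by rewrite ler_wpM2l // !mulr_ge0 ?powR_ge0 ?exprn_ge0 ?(ltW la0).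
    have p4 : (p j `^ v) ^+ 4 = p j `^ r * p j ^+ 2.
      have [P ->] := lnE _ pj; rewrite !powR_expR -!expRM_natl -expRD; congr expR.
      by rewrite /v; field.
    rewrite le_eqVlt; apply/orP; left; apply/eqP.
    transitivity (n%:R ^+ 2 * la ^+ 4 * (p j `^ v) ^+ 4); first by ring.
    by rewrite p4; field.
  apply: (le_sep_radius p t eta _ (1 - e)) => //; first by rewrite /e; lra.
  move=> rho psi /andP[r1 hr].
  have h01 : in_cube (fun _ : 'I_N => 1 / 2 : R).
    by move=> j; rewrite divr_ge0 //= ler_pdivrMr // mul1r ler1n.
  have Q01 b : in_cube (sign_alt p g b).
    exact: in_cube_sign_alt.
  have good b : ~~ false -> rho <= lpnorm t (fun j => p j - sign_alt p g b j).
    move=> _; apply: le_trans hr _; apply: le_lpnorm => //.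
      by rewrite mulr_ge0 ?sqrtr_ge0 // divr_ge0 // ltW.
    have -> : \sum_j `|p j - sign_alt p g b j| `^ t = \sum_j g j `^ t.
      apply: eq_bigr => j _; congr (_ `^ _); have /andP[g0 _] := hg j.
      rewrite /sign_alt /sgnb opprD addrA subrr add0r normrN normrM.
      by case: (b ord0 j); rewrite ?normrN ?normr1 mul1r ger0_norm.
    apply: (@le_trans _ _ (la `^ t * (S / 2))); last first.
      apply: (@le_trans _ _ (la `^ t * \sum_(j | G j) p j `^ r)).
        by rewrite ler_wpM2l ?powR_ge0.
      rewrite mulr_sumr big_mkcond; apply: ler_sum => j _; rewrite /g.
      case: ifP => Gj; last by rewrite powR_ge0.
      rewrite powRM ?powR_ge0 ?(ltW la0) // -powRrM.
      have -> : v * t = r.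
        have -> : v * t = (2 * t - r * (4 - t)) / 4 + r by rewrite /v; field.
        by rewrite rE; field.
      by [].
    rewrite powRM ?sqrtr_ge0 ?divr_ge0 ?(ltW c0) // bulk_rate_powR // -/S.
    have -> : la `^ t * (S / 2) = c `^ t / 2 * (S `^ (1 - t / 4) / n%:R `^ (t / 2)).
      have -> : la `^ t * (S / 2) = la `^ t * S / 2 by field.
      have -> : la `^ t * S = c `^ t * (S `^ (1 - t / 4) / n%:R `^ (t / 2)).
        by rewrite SE nE cE /la !powR_expR -!expRN -!expRD; congr expR; field.
      by field; rewrite gt_eqF // powR_gt0.
    rewrite ler_wpM2r ?divr_ge0 ?powR_ge0 //.
    rewrite powRM ?invr_ge0 ?(ltW c0) // ler_wpM2l ?powR_ge0 //.
    by apply: ge1r_powR => //; rewrite invr_gt0 ltr0n invf_le1 // ler1n.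
  have := risk_prior p t rho psi _ (sign_alt p g) (fun=> false) p01 h01 Q01 good.
  have -> : Pq (fun _ : 'I_N => 1 / 2 : R) (fun _ : sample N 1 => false) = 0.
    by rewrite /Pq big_pred0_eq.
  rewrite subr0; apply: le_trans.
  exact: sign_prior_risk.
pose B (j : 'I_N) := (j < I)%N && ~~ (la <= p j `^ u).
have SB : S / 2 <= \sum_(j | B j) p j `^ r.
  have : S = \sum_(j | G j) p j `^ r + \sum_(j | B j) p j `^ r.
    by rewrite /S /bulk_sum (bigID (fun j => la <= p j `^ u)).
  by move: SG; lra.
pose A := c ^+ 4 / n%:R ^+ 2.
have A0 : 0 < A by rewrite divr_gt0 // exprn_gt0.
have AE : A = la ^+ 4 * S by rewrite /A -la4; field; rewrite gt_eqF.
(* On [B], [p^u < la] and [4 u = 2 - r] give [p^2 <= la^4 p^r]. *)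
have hx : \sum_(j | B j) p j ^+ 2 <= A.
  rewrite AE /S /bulk_sum mulr_sumr big_mkcond [leRHS]big_mkcond.
  apply: ler_sum => j _; rewrite /B; case: (ltnP j I) => //= jI.
  rewrite -ltNge; case: ltP => hj; last first.
    by rewrite mulr_ge0 ?powR_ge0 // exprn_ge0 // ltW.
  have -> : p j ^+ 2 = (p j `^ u) ^+ 4 * p j `^ r.
    have [P ->] := lnE _ (pI j jI); rewrite !powR_expR -!expRM_natl -expRD; congr expR.
    by rewrite /u; field.
  by rewrite ler_wpM2r ?powR_ge0 // lerXn2r ?nnegrE ?powR_ge0 ?(ltW la0) // ltW.
have hy : \sum_(j | B j) (1 : R) <= I%:R.
  rewrite -[leRHS]mulr1 -(sum_ord_lt_const I 1 IN) big_mkcond [leRHS]big_mkcond.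
  by apply: ler_sum => j _; rewrite /B; case: (j < I)%N => //=; case: ifP.
have hs : 0 <= r / 2 <= 1 by apply/andP; split; lra.
have Pj j : B j -> [/\ 0 <= p j ^+ 2, 0 <= (1 : R) &
    p j `^ r <= (p j ^+ 2) `^ (r / 2) * 1 `^ (1 - r / 2)].
  move=> _; split; rewrite ?sqr_ge0 // powR1 mulr1 -powR_mulrn // -powRrM.
  by have -> : 2%:R * (r / 2) = r by field.
have := sum_interp _ B _ (fun j => p j ^+ 2) (fun=> 1) A I%:R (r / 2) hs A0 i0 Pj hx hy.
move=> /(le_trans SB) hS.
have S_le : S <= 4 * (A `^ (r / 2) * I%:R `^ (1 - r / 2)) by lra.
apply: le_trans (le_bulk_rate n t _ _ ht (ltW S0) S_le) _.
have [W iE] := lnE _ i0.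
rewrite bulk_rateE /mesh /A iE nE cE.
rewrite -!expRM_natl -expRN -expRD !powR_expR -?expRN -?expRD.
rewrite powRM ?powR_ge0 ?expR_ge0 // powRM ?expR_ge0 // powRM ?powR_ge0 //.
rewrite -!powRrM !powR_expR -(mulrA (powR _ _)) -expRD -[leRHS]mulrA -expRD.
apply: ler_pM; rewrite ?powR_ge0 ?expR_ge0 //.
  apply: ler1_powR; first by rewrite ler1n.
  have -> : (r_exp t)^-1 / 2 = (4 - t) / 4 / t.
    by rewrite /r_exp; field; rewrite !gt_eqF //; have /andP[] := ht; lra.
  by rewrite ler_pdivrMr //; have := t1; lra.
rewrite le_eqVlt; apply/orP; left; apply/eqP; congr expR.
rewrite /r /r_exp; field; rewrite !gt_eqF //; have /andP[] := ht; lra.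
Qed.

End LowerBoundRadius.

(** * Assembling the upper and lower bounds *)

Theorem theorem1 (R : realType) (eta : R) :
  0 < eta < 1 ->
  exists cI0 : R, 0 < cI0 /\
  forall (t cI : R), 1 <= t <= 2 -> 0 < cI <= cI0 ->
  exists c C : R, 0 < c /\ c <= C /\
  forall (N n : nat) (p : vec R N),
    (2 <= N)%N -> (2 <= n)%N -> ~~ odd n -> standing p ->
    c * rate n cI t p <= sep_radius n p t eta /\
    sep_radius n p t eta <= C * rate n cI t p.
Proof.
move=> heta; have /andP[e0 e1] := heta.
(* This threshold is required by the tail lower bound; the tests accept any positive [cI]. *)
exists ((1 - eta) / 16); split; first by lra.
move=> t cI ht /andP[cI0 cIe]; have /andP[t1 t2] := ht.
have ex : 0 <= (2 - t) / t by rewrite divr_ge0 //; lra.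
have ex1 : (2 - t) / t <= 1 by rewrite ler_pdivrMr; lra.
have t0 : t != 0 by rewrite gt_eqF //; lra.
have [C C0 hC] := minimax_risk_rate eta t cI heta ht cI0.
have K0 := mesh_cst_gt0 cI t cI0; set K := mesh_cst cI t in K0.
(* The second entry gives [4 cs K <= 1 / 2]: in the mesh case of the dichotomy, the bulk term is
   then at most half of bulk plus tail, hence at most the tail term. *)
pose cs := Num.min ((1 - eta) / 8) (8 * K)^-1.
have K8 : 0 < (8 * K)^-1 by rewrite invr_gt0 mulr_gt0.
have cs0 : 0 < cs by rewrite lt_min K8 andbT; lra.
have cs1 : cs <= (1 - eta) / 8 by rewrite ge_min lexx.
have csK : 4 * cs * K <= 1 / 2.
  have h : cs <= (8 * K)^-1 by rewrite ge_min lexx orbT.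
  have := ler_wpM2r (ltW K0) h.
  have -> : (8 * K)^-1 * K = 8^-1 by field; rewrite gt_eqF.
  lra.
pose c1 := (1 - eta) / 64; pose c2 := Num.min c1 (cs / 2).
have c10 : 0 < c1 by rewrite /c1; lra.
have c20 : 0 < c2 by rewrite lt_min c10; lra.
have c21 : c2 <= c1 by rewrite ge_min lexx.
have c2s : c2 <= cs / 2 by rewrite ge_min lexx orbT.
(* Each of the three terms times [c2] is below the radius, hence the division by 3; adding [c2 / 3]
   to [C] keeps the constants ordered. *)
exists (c2 / 3), (C + c2 / 3); split; first by lra.
split; first by lra.
move=> N n p N2 n2 nev sp; have [rpos hmm] := hC N n p n2 nev sp.
have n0 : (0 < n)%N by apply: ltn_trans n2.
have N0 : (0 < N)%N by apply: ltn_trans N2.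
have p01 : in_cube p by have [] := sp.
have Crp : 0 < C * rate n cI t p by rewrite mulr_gt0.
split; last first.
  apply: le_trans (sep_radius_le p t _ eta Crp hmm) _.
  by rewrite ler_wpM2r ?(ltW rpos) // lerDl; lra.
have att : exists rho, 0 < rho /\ minimax_risk n p t rho <= eta.
  by exists (C * rate n cI t p).
have hn := sep_radius_ge_inv p t eta ht heta sp n0 att N0.
rewrite rateE //; set I := Iidx n cI p.
rewrite -/(bulk_sum I t p) -/(tail_sum I p).
have nn0 : 0 < n%:R :> R by rewrite ltr0n.
set s := sep_radius n p t eta in hn *.
have inv0 : 0 < n%:R^-1 :> R by rewrite invr_gt0.
have T0 : 0 <= tail_rate n t (tail_sum I p) by rewrite divr_ge0 ?powR_ge0.
have B0 : 0 <= bulk_rate n t (bulk_sum I t p) by rewrite sqrtr_ge0.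
have hT : c1 * tail_rate n t (tail_sum I p) <= s.
  have [nM|nM] := leP 4 (n%:R * tail_sum I p).
    exact: (sep_radius_ge_tail p t eta ht heta sp n0 att cI cI0 cIe nM).
  (* When [n M < 4] the two exponents of [n] add up to 1, and the tail term falls under the [1 / n]
     bound. *)
  suff h4 : tail_rate n t (tail_sum I p) <= 4 / n%:R.
    apply: le_trans hn; apply: le_trans (ler_wpM2l (ltW c10) h4) _.
    by rewrite mulrA ler_wpM2r ?(ltW inv0) // /c1; lra.
  have M0 := tail_sum_ge0 I p sp.
  have M4 : tail_sum I p <= 4 / n%:R by rewrite ler_pdivlMr // mulrC ltW.
  apply: le_trans (le_tail_rate n t _ _ ht M0 M4) _.
  rewrite /tail_rate powRM ?invr_ge0 // -mulrA.
  have -> : n%:R^-1 `^ ((2 - t) / t) / n%:R `^ ((2 * t - 2) / t) = n%:R^-1 :> R.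
    have -> : n%:R = expR (ln n%:R) :> R by rewrite lnK.
    rewrite -!expRN !powR_expR -expRN -expRD; congr expR; field.
    exact: t0.
  by rewrite ler_wpM2r ?(ltW inv0) // ler1_powR // ler1n.
have hB : c2 * bulk_rate n t (bulk_sum I t p) <= s.
  have hBT : bulk_rate n t (bulk_sum I t p) <= tail_rate n t (tail_sum I p) ->
      c2 * bulk_rate n t (bulk_sum I t p) <= s.
    by move=> h; apply: le_trans hT; apply: ler_pM => //; rewrite ltW.
  case: (posnP I) => [I0|I0].
    apply: hBT; rewrite (_ : bulk_rate n t _ = 0) //.
    rewrite /bulk_sum big_pred0; last by move=> j; rewrite I0.
    by rewrite /bulk_rate powR0 ?mul0r ?sqrtr0 // invr_eq0 gt_eqF // r_exp_gt0.
  have [h|h] := sep_radius_ge_bulk p t eta ht heta sp n0 att cI cs cI0 cs0 cs1 I0.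
    by apply: le_trans h; rewrite ler_wpM2r.
  apply: hBT; have hm := mesh_le_rates t cI p ht cI0 n0 sp I0.
  have cs4 : 0 <= 4 * cs by lra.
  have := le_trans h (ler_wpM2l cs4 hm); rewrite mulrA -/I -/K.
  set b := bulk_rate _ _ _ in B0 *; set m := tail_rate _ _ _ in T0 *.
  move=> h'; have bm : 0 <= b + m by rewrite addr_ge0.
  have := ler_wpM2r bm csK; lra.
have h2 : c2 * tail_rate n t (tail_sum I p) <= s.
  by apply: le_trans hT; rewrite ler_wpM2r.
have h3 : c2 * n%:R^-1 <= s.
  by apply: le_trans hn; rewrite ler_wpM2r ?(ltW inv0) //; move: c21; rewrite /c1; lra.
lra.
Qed.
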